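(* Let $T$ be a countable complete first-order theory that is supersimple. Then the number of pairwise nonisomorphic countable models of $T$ is either $1$ or at least $\aleph_0$ (i.e. it is never finite and strictly greater than $1$).
   Context: $T$ is a complete theory in a countable first-order language $L$ with no finite models; we work inside a large saturated monster model $\bar M$ of $T$, tuples are finite, and sets are small subsets of $\bar M$. A (possibly partial) type $p$ forks over a set $A$ if there are an $L$-formula $\varphi(\bar x,\bar y)$ and tuples $\bar c_i$ ($i<\omega$) such that $p\vdash\varphi(\bar x,\bar c_0)$, $tp(\bar c_i/A)=tp(\bar c_0/A)$ for all $i$, and $\{\varphi(\bar x,\bar c_i)\mid i<\omega\}$ is $k$-inconsistent for some $k<\omega$. $T$ is supersimple if for every complete type $p\in S(B)$ there is a finite $A\subseteq B$ such that $p$ does not fork over $A$. *)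

(* Defs.v *)
From Stdlib Require List.
From mathcomp Require Import all_boot.
Import List.ListNotations.
Notation In := List.In.

Set Implicit Arguments.
Unset Strict Implicit.
Unset Printing Implicit Defensive.

Record language := Language {
  fsym : Type; rsym : Type;
  farity : fsym -> nat; rarity : rsym -> nat }.

Definition countable_language (L : language) : Prop :=
  (exists enc : fsym L -> nat, injective enc) /\
  (exists enc : rsym L -> nat, injective enc).

Inductive term (L : language) : Type :=
  | Var : nat -> term L
  | App : forall f : fsym L, ('I_(farity f) -> term L) -> term L.

Inductive formula (L : language) : Type :=
  | Fals : formula L
  | Eqf : term L -> term L -> formula L
  | Rel : forall r : rsym L, ('I_(rarity r) -> term L) -> formula L
  | Imp : formula L -> formula L -> formula L
  | All : nat -> formula L -> formula L.

Fixpoint term_free L (v : nat) (t : term L) : Prop :=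
  match t with
  | Var w => v = w
  | App f args => exists i, term_free v (args i)
  end.

Fixpoint free L (v : nat) (phi : formula L) : Prop :=
  match phi with
  | Fals => False
  | Eqf t1 t2 => term_free v t1 \/ term_free v t2
  | Rel r args => exists i, term_free v (args i)
  | Imp p q => free v p \/ free v q
  | All w p => v <> w /\ free v p
  end.

Definition sentence L (phi : formula L) : Prop := forall v, ~ free v phi.

Definition theory L := formula L -> Prop.

Record struc (L : language) := Struc {
  carrier :> Type;
  witness : carrier;
  fint : forall f : fsym L, ('I_(farity f) -> carrier) -> carrier;
  rint : forall r : rsym L, ('I_(rarity r) -> carrier) -> Prop }.
Arguments fint {L} s f _.
Arguments rint {L} s r _.

Definition upd (X : Type) (e : nat -> X) (v : nat) (x : X) : nat -> X :=
  fun w => if w == v then x else e w.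

Fixpoint eval L (M : struc L) (e : nat -> M) (t : term L) : M :=
  match t with
  | Var v => e v
  | App f args => fint M f (fun i => eval e (args i))
  end.

Fixpoint sat L (M : struc L) (e : nat -> M) (phi : formula L) : Prop :=
  match phi with
  | Fals => False
  | Eqf t1 t2 => eval e t1 = eval e t2
  | Rel r args => rint M r (fun i => eval e (args i))
  | Imp p q => sat e p -> sat e q
  | All v p => forall x : M, sat (upd e v x) p
  end.

Definition Neg L (phi : formula L) : formula L := Imp phi (Fals L).

Definition is_model L (T : theory L) (M : struc L) : Prop :=
  forall phi, T phi -> forall e : nat -> M, sat e phi.

Definition complete_theory L (T : theory L) : Prop :=
  (forall phi, T phi -> sentence phi) /\
  (exists M : struc L, is_model T M) /\
  (forall phi, sentence phi ->
     (forall M : struc L, is_model T M -> forall e : nat -> M, sat e phi) \/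
     (forall M : struc L, is_model T M -> forall e : nat -> M, sat e (Neg phi))).

Definition finite_struc L (M : struc L) : Prop :=
  exists l : list M, forall x : M, In x l.

Definition no_finite_models L (T : theory L) : Prop :=
  forall M : struc L, is_model T M -> ~ finite_struc M.

Definition countable_struc L (M : struc L) : Prop :=
  exists enc : M -> nat, injective enc.

Definition isomorphic L (M N : struc L) : Prop :=
  exists (h : M -> N) (h' : N -> M),
    cancel h h' /\ cancel h' h /\
    (forall f args, h (fint M f args) = fint N f (fun i => h (args i))) /\
    (forall r args, rint M r args <-> rint N r (fun i => h (args i))).

Definition elem_emb L (M N : struc L) (f : M -> N) : Prop :=
  forall (phi : formula L) (e : nat -> M), sat e phi <-> sat (fun v => f (e v)) phi.

(** * Tuples and types.
    An n-tuple in M is represented by an assignment u : nat -> M of which only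
    the values u 0, ..., u (n-1) matter.  [tcat n u e] is the assignment that
    puts the tuple u on the variables 0..n-1 and the assignment e (parameters)
    on the variables n, n+1, ... *)
Definition tcat (X : Type) (n : nat) (u e : nat -> X) : nat -> X :=
  fun v => if v < n then u v else e (v - n).

Definition same_type L (N : struc L) (m : nat) (u w : nat -> N) (P : N -> Prop) : Prop :=
  forall (psi : formula L) (e : nat -> N),
    (forall v, free (m + v) psi -> P (e v)) ->
    (sat (tcat m u e) psi <-> sat (tcat m w e) psi).

(** * Forking.
    Let B ⊆ M, a an n-tuple of M, p = tp(a/B), A ⊆ B.  p forks over A iff there
    are an elementary extension f : M -> N, an L-formula phi(x,y) (x of length
    n, y of length m, no other free variables), and m-tuples c_i (i < ω) in N
    with: p ⊢ phi(x, c_0) (i.e. in every elementary extension of N, every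
    realisation of p satisfies phi(x, c_0)); tp(c_i/A) = tp(c_0/A) for all i;
    and {phi(x, c_i) | i < ω} is k-inconsistent for some k.
    (This is the monster-model definition: any small elementary extension of M
    embeds over M into the monster and conversely.) *)
Definition forks L (M : struc L) (B : M -> Prop) (n : nat) (a : nat -> M)
    (A : M -> Prop) : Prop :=
  exists (N : struc L) (f : M -> N), elem_emb f /\
  exists (m : nat) (phi : formula L) (c : nat -> nat -> N),
    (forall v, free v phi -> v < n + m) /\
    (forall (N' : struc L) (g : N -> N'), elem_emb g ->
       forall a' : nat -> N',
         (forall (psi : formula L) (e : nat -> M),
            (forall v, free (n + v) psi -> B (e v)) ->
            (sat (tcat n a' (fun v => g (f (e v)))) psi <-> sat (tcat n a e) psi)) ->
         sat (tcat n a' (fun v => g (c 0 v))) phi) /\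
    (forall i, same_type m (c i) (c 0) (fun y => exists x, A x /\ y = f x)) /\
    (exists k : nat, forall s : 'I_k -> nat, injective s ->
       ~ exists x : nat -> N, forall j : 'I_k, sat (tcat n x (c (s j))) phi).

(** T is supersimple: every complete type over any (small) set B does not
    fork over some finite A ⊆ B. Complete types over B are exactly the
    tp(a/B) for tuples a in models M of T containing B. *)
Definition supersimple L (T : theory L) : Prop :=
  forall M : struc L, is_model T M ->
  forall (B : M -> Prop) (n : nat) (a : nat -> M),
    exists l : list M, (forall x, In x l -> B x) /\
      ~ forks B n a (fun x => In x l).

(* Main.v *)
Require Import Defs.
From mathcomp Require Import all_boot.
From mathcomp Require Import boolp classical_sets filter.

(** Suppose [T] has finitely many countable models, but more than one. By the omitting types theorem there is a type [p = tp(b)] that is powerful: every type over the empty set is semi-isolated over [b]. If [p] were isolated, then all types would be isolated and [T] would be countably categorical; so [p] is not isolated.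

Write [c -> e], for realizations of [p], when some formula [phi(c, y)] true of [e] implies [p(y)]. If [l -> y -> f], then the formula saying that [y] lies between [l] and [f] 2-divides over the empty set: as [p] is not isolated, there are pairs [(l_t, f_t)] near [(l, f)] with [f_t] outside [p] and [l_t] too close to [p] to lie below any earlier [f_s]. Hence [c -> e] forces [c] and [e] to be dependent; otherwise some [l] with [tp(l, c) = tp(c, e)], independent of [c, e], would make [c] independent of [l, e] by symmetry and transitivity.

On the other hand, applied to independent pairs [(c', e')], powerfulness gives [c_0 -> c_1 -> ...] with [c_n -> e_n] and the [e_n] independent. Supersimplicity makes [c_0] independent of some [e_n] over [e_0, ..., e_(n-1)], hence independent of [e_n], although [c_0 -> e_n].

All of this takes place in one countably saturated model, an ultrapower of a model of [T]. *)

(** No indiscernible sequences are extracted. [dvd] asks only for conjugates of a parameter with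
    [k]-inconsistent instances, and what Kim's lemma would give is obtained by counting. Local
    character is applied in one place, [no_dividing_chain]: a finite tuple satisfies no infinite
    sequence of formulas each dividing over the parameters of the earlier ones. By compactness such
    chains have bounded length once the formulas come from a fixed finite list; extension and
    symmetry hold because a counterexample would produce arbitrarily long chains.

    Until [nd_sym] the relation [nd] has a direction. [nd_extend] controls the type of the left-hand
    tuple, whereas a chain needs each new parameter to keep dividing over the earlier ones, which is
    [Ind], the opposite direction. This mismatch dictates the order in which independent sequences
    are built.

    Automorphisms are not at hand in a model that is only countably saturated, so conjugation is
    done by completing tuples with [homogeneous]; this confines the arguments to countable base sets
    and countable tuples. *)

Set Implicit Arguments.
Unset Strict Implicit.
Unset Printing Implicit Defensive.

Local Open Scope classical_set_scope.

(** * Syntax *)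

Section Syntax.
Variable L : language.
Implicit Types (t : term L) (phi : formula L).

Lemma eval_agree (M : struc L) (e e' : nat -> M) t :
  (forall v, term_free v t -> e v = e' v) -> eval e t = eval e' t.
Proof.
elim: t => [v|f args IH] /= H; first exact: H.
congr (fint M f _); apply/funext => i; apply: IH => v Hv; apply: H.
by exists i.
Qed.

Lemma sat_agree (M : struc L) phi (e e' : nat -> M) :
  (forall v, free v phi -> e v = e' v) -> sat e phi <-> sat e' phi.
Proof.
elim: phi e e' => [|t1 t2|r args|p IHp q IHq|v p IHp] e e' H //=.
- rewrite (@eval_agree _ e e' t1) ?(@eval_agree _ e e' t2) // => v Hv; apply: H; [by right|by left].
- suff -> : (fun i => eval e (args i)) = (fun i => eval e' (args i)) by [].
  by apply/funext => i; apply: eval_agree => v Hv; apply: H; exists i.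
- have := IHp e e' (fun v Hv => H v (or_introl Hv)).
  have := IHq e e' (fun v Hv => H v (or_intror Hv)); tauto.
- have K x : sat (upd e v x) p <-> sat (upd e' v x) p.
    apply: IHp => w Hw; rewrite /upd; case: eqP => // nwv.
    by apply: H; split.
  by split=> A x; apply/K.
Qed.

Lemma sat_agree1 (M : struc L) phi (e e' : nat -> M) :
  (forall v, free v phi -> e v = e' v) -> sat e phi -> sat e' phi.
Proof. by move=> /sat_agree[]. Qed.

Fixpoint term_bound t : nat :=
  match t with
  | Var v => v.+1
  | App f args => \max_(i < farity f) term_bound (args i)
  end.

Lemma term_boundP t v : term_free v t -> v < term_bound t.
Proof.
elim: t => [w|f args IH] /=; first by move=> ->.
case=> i /IH Hi; apply: leq_trans Hi _.
exact: (leq_bigmax (F := fun i => term_bound (args i))).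
Qed.

Fixpoint formula_bound phi : nat :=
  match phi with
  | Fals => 0
  | Eqf t1 t2 => maxn (term_bound t1) (term_bound t2)
  | Rel r args => \max_(i < rarity r) term_bound (args i)
  | Imp p q => maxn (formula_bound p) (formula_bound q)
  | All w p => formula_bound p
  end.

Lemma formula_boundP phi v : free v phi -> v < formula_bound phi.
Proof.
elim: phi => [|t1 t2|r args|p IHp q IHq|w p IHp] //=.
- by case=> /term_boundP H; rewrite leq_max H ?orbT.
- case=> i /term_boundP Hi; apply: leq_trans Hi _.
  exact: (leq_bigmax (F := fun i => term_bound (args i))).
- by case=> [/IHp|/IHq] H; rewrite leq_max H ?orbT.
- by case=> _ /IHp.
Qed.

Fixpoint rename_term (rho : nat -> nat) t : term L :=
  match t with
  | Var v => Var L (rho v)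
  | App f args => App (fun i => rename_term rho (args i))
  end.

Lemma eval_rename (M : struc L) (e : nat -> M) rho t :
  eval e (rename_term rho t) = eval (e \o rho) t.
Proof.
elim: t => [//|f args IH] /=; congr (fint M f _); apply/funext => i; exact: IH.
Qed.

Lemma free_rename_term rho t v :
  term_free v (rename_term rho t) -> exists2 w, term_free w t & v = rho w.
Proof.
elim: t => [w /= ->|f args IH /= [i /IH[w Hw ->]]]; first by exists w.
by exists w => //; exists i.
Qed.

Lemma rename_formula phi (rho : nat -> nat) : exists phi',
  (forall v, free v phi' -> exists2 w, free w phi & v = rho w) /\
  (forall (M : struc L) (e : nat -> M), sat e phi' <-> sat (e \o rho) phi).
Proof.
elim: phi rho => [|t1 t2|r args|p IHp q IHq|v p IHp] rho.
- by exists (Fals L).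
- exists (Eqf (rename_term rho t1) (rename_term rho t2)); split=> [v /= []|M e /=].
  + by case/free_rename_term => w Hw ->; exists w => //; left.
  + by case/free_rename_term => w Hw ->; exists w => //; right.
  + by rewrite !eval_rename.
- exists (Rel (fun i => rename_term rho (args i))); split=> [v /= [i]|M e /=].
  + by case/free_rename_term => w Hw ->; exists w => //; exists i.
  + suff -> : (fun i => eval e (rename_term rho (args i)))
      = (fun i => eval (e \o rho) (args i)) by [].
    by apply/funext => i; rewrite eval_rename.
- have [p' [Fp Sp]] := IHp rho; have [q' [Fq Sq]] := IHq rho.
  exists (Imp p' q'); split=> [v /= []|M e /=].
  + by case/Fp => w Hw ->; exists w => //; left.
  + by case/Fq => w Hw ->; exists w => //; right.
  + by have := Sp M e; have := Sq M e; tauto.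
(* The bound variable moves above [rho u] for every [u] that can be free in [p], so nothing is
   captured even when [rho] is not injective. *)
- pose w := (\max_(u < formula_bound p) rho u).+1.
  pose rho' u := if u == v then w else rho u.
  have [p' [Fp Sp]] := IHp rho'.
  exists (All w p'); split=> [x /= [xw]|M e /=].
    case/Fp => u Hu; rewrite /rho'; case: eqP => // nuv ->; exists u => //.
  have K x : sat (upd e w x) p' <-> sat (upd (e \o rho) v x) p.
    apply: iff_trans (Sp _ _) _; apply: sat_agree => u Hu.
    rewrite /= /rho' /upd; case: (u =P v) => [_|nuv]; first by rewrite eqxx.
    rewrite ltn_eqF // ltnS.
    exact: (leq_bigmax (F := fun u : 'I__ => rho u) (Ordinal (formula_boundP Hu))).
  by split=> A x; apply/K.
Qed.

Definition Ex (v : nat) phi : formula L := Neg (All v (Neg phi)).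

Lemma sat_Ex (M : struc L) (e : nat -> M) v phi :
  sat e (Ex v phi) <-> exists x, sat (upd e v x) phi.
Proof.
split=> /= [H|[x Hx] H]; last exact: (H x).
by apply: contrapT => K; apply: H => x Hx; apply: K; exists x.
Qed.

Lemma exists_block phi (l : seq nat) : exists phi',
  (forall v, free v phi' -> free v phi /\ v \notin l) /\
  (forall (M : struc L) (e : nat -> M),
     sat e phi' <-> exists h : nat -> M, sat (fun v => if v \in l then h v else e v) phi).
Proof.
elim: l => [|w l [psi [F S]]].
  exists phi; split=> [//|M e]; split=> [H|[h]]; last exact.
  by exists e.
exists (Ex w psi); split=> [v /=|M e].
  case=> // -[nvw [Fv|//]]; rewrite in_cons negb_or; have [Hv ->] := F v Fv.
  by split=> //; rewrite andbT; apply/eqP.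
apply: iff_trans (sat_Ex _ _ _) _; split=> [[x /S [h Hh]]|[h Hh]].
  exists (fun v => if v \in l then h v else x).
  apply: sat_agree1 Hh => v _; rewrite in_cons /upd.
  by case: (v \in l); rewrite ?orbT ?orbF.
exists (h w); apply/S; exists h; apply: sat_agree1 Hh => v _ /=.
rewrite in_cons /upd; case: (v \in l); rewrite ?orbT ?orbF //.
by case: eqP => // ->.
Qed.

End Syntax.

(** * Definable predicates on tuples *)

Definition jn (I J U : Type) (a : I -> U) (b : J -> U) : I + J -> U :=
  fun k => match k with inl i => a i | inr j => b j end.

Lemma jn_eta (I J U : Type) (a : I + J -> U) : jn (a \o inl) (a \o inr) = a.
Proof. by apply/funext => -[]. Qed.

Section Definable.
Variables (L : language) (U : struc L).
Implicit Types (B C : set U).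

Definition oval (I : Type) (a : I -> U) (z : option (I + U)) : U :=
  match z with
  | Some (inl i) => a i
  | Some (inr u) => u
  | None => witness U
  end.

Definition admissible B (I : Type) (z : option (I + U)) : Prop :=
  match z with
  | Some (inl _) => True
  | Some (inr u) => B u
  | None => False
  end.

(* The map [s] tells which variables of [phi] stand for coordinates of the tuple and which for parameters from [B]. *)
Definition DB B (I : Type) (R : (I -> U) -> Prop) : Prop :=
  exists (phi : formula L) (s : nat -> option (I + U)),
    (forall v, free v phi -> admissible B (s v)) /\
    (forall a, R a <-> sat (fun v => oval a (s v)) phi).

Lemma DB_ext B I (R R' : (I -> U) -> Prop) :
  (forall a, R a <-> R' a) -> DB B R -> DB B R'.
Proof.
move=> H; suff -> : R = R' by [].
by apply/funext => a; apply/propext.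
Qed.

Lemma DB_mono B C I (R : (I -> U) -> Prop) : B `<=` C -> DB B R -> DB C R.
Proof.
move=> BC [phi [s [F S]]]; exists phi, s; split=> // v /F.
by case: (s v) => [[]|] //= u /BC.
Qed.

Lemma DB_imp B I (R R' : (I -> U) -> Prop) :
  DB B R -> DB B R' -> DB B (fun a => R a -> R' a).
Proof.
move=> [phi [s [F S]]] [psi [t [G T]]].
(* Even variables carry the first formula and odd ones the second, so the two variable assignments
   can be merged. *)
have [phi' [F' S']] := rename_formula phi double.
have [psi' [G' T']] := rename_formula psi (fun v => v.*2.+1).
exists (Imp phi' psi'), (fun v => if odd v then t v./2 else s v./2); split=> [v /= []|a /=].
- by case/F' => w /F Fw ->; rewrite odd_double doubleK.
- by case/G' => w /G Gw ->; rewrite /= odd_double /= uphalf_double.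
- have -> : R a <-> sat (fun v => oval a (if odd v then t v./2 else s v./2)) phi'.
    apply: iff_trans (S a) _; apply: iff_trans (iff_sym (S' _ _)).
    by apply: sat_agree => v _ /=; rewrite odd_double doubleK.
  have -> : R' a <-> sat (fun v => oval a (if odd v then t v./2 else s v./2)) psi'.
    apply: iff_trans (T a) _; apply: iff_trans (iff_sym (T' _ _)).
    by apply: sat_agree => v _ /=; rewrite odd_double /= uphalf_double.
  by [].
Qed.

Lemma DB_False B I : DB B (fun _ : I -> U => False).
Proof. by exists (Fals L), (fun _ => None). Qed.

Lemma DB_const B I (P : Prop) : DB B (fun _ : I -> U => P).
Proof.
have [p|np] := lem P; last by apply: DB_ext (DB_False B I).
by apply: DB_ext (DB_imp (DB_False B I) (DB_False B I)).
Qed.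

Lemma DB_not B I (R : (I -> U) -> Prop) : DB B R -> DB B (fun a => ~ R a).
Proof. by move=> H; apply: DB_imp H (DB_False B I). Qed.

Lemma DB_and B I (R R' : (I -> U) -> Prop) :
  DB B R -> DB B R' -> DB B (fun a => R a /\ R' a).
Proof.
move=> H H'; apply: DB_ext (DB_not (DB_imp H (DB_not H'))) => a.
split=> [K|[x y] K]; last exact: K.
by split; apply: contrapT => N; apply: K => r r'; apply: N.
Qed.

Lemma DB_all_in B I (T : eqType) (R : T -> (I -> U) -> Prop) (l : seq T) :
  (forall t, t \in l -> DB B (R t)) -> DB B (fun a => forall t, t \in l -> R t a).
Proof.
elim: l => [|t l IH] H; first by apply: DB_ext (DB_const B I True).
have Hl : DB B (fun a => forall t, t \in l -> R t a).
  by apply: IH => u ul; apply: H; rewrite in_cons ul orbT.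
have Ht : DB B (R t) by apply: H; rewrite mem_head.
apply: DB_ext (DB_and Ht Hl) => a; split=> [[x y] u|K].
  by rewrite in_cons => /orP[/eqP ->|/y].
by split=> [|u ul]; apply: K; rewrite in_cons ?eqxx ?ul ?orbT.
Qed.

Lemma DB_all_list B I (l : list ((I -> U) -> Prop)) :
  (forall R, In R l -> DB B R) -> DB B (fun a => forall R, In R l -> R a).
Proof.
elim: l => [|R l IH] H; first by apply: DB_ext (DB_const B I True).
have Hl := IH (fun R' i => H R' (or_intror i)).
apply: DB_ext (DB_and (H R (or_introl erefl)) Hl) => a; split=> [[x y] R' [<-|/y]|K] //.
by split=> [|R' i]; apply: K; [left|right].
Qed.

Lemma DB_eq B I (i j : I) : DB B (fun a => a i = a j).
Proof.
exists (Eqf (Var L 0) (Var L 1)), (fun v => if v is 0 then Some (inl i) else Some (inl j)).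
by split=> [v /= [->|->]|a].
Qed.

Lemma DB_reind B I J (r : I -> J) (R : (I -> U) -> Prop) :
  DB B R -> DB B (fun a : J -> U => R (a \o r)).
Proof.
move=> [phi [s [F S]]].
exists phi, (fun v => if s v is Some z then
  Some (match z with inl i => inl (r i) | inr u => inr u end) else None); split=> [v /F|a].
  by case: (s v) => [[]|].
apply: iff_trans (S _) _; apply: sat_agree => v _.
by case: (s v) => [[]|].
Qed.

Lemma DB_spec B I K (R : (I + K -> U) -> Prop) (a : K -> U) :
  range a `<=` B -> DB B R -> DB B (fun x => R (jn x a)).
Proof.
move=> aB [phi [s [F S]]].
exists phi, (fun v => if s v is Some z then
  Some (match z with inl (inl i) => inl i | inl (inr k) => inr (a k) | inr u => inr u end)
  else None); split=> [v /F|x].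
  by case: (s v) => [[[]|]|] //= k _; apply: aB; exists k.
apply: iff_trans (S _) _; apply: sat_agree => v _.
by case: (s v) => [[[]|]|].
Qed.

Lemma DB_abs B I K (R : (I -> U) -> Prop) (a : K -> U) :
  DB (B `|` range a) R ->
  exists R', DB B R' /\ (forall x, R x <-> R' (jn x a)).
Proof.
move=> [phi [s [F S]]].
pose g u : option ((I + K) + U) :=
  match pselect (exists k, a k = u) with
  | left e => Some (inl (inr (projT1 (cid e))))
  | right _ => Some (inr u)
  end.
pose t v := if s v is Some z then
  match z with inl i => Some (inl (inl i)) | inr u => g u end else None.
exists (fun x => sat (fun v => oval x (t v)) phi); split.
  exists phi, t; split=> // v /F; rewrite /t /g.
  case: (s v) => [[|u]|] //=; case: pselect => //= ne [//|[k _ ak]].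
  by case: ne; exists k.
move=> x; apply: iff_trans (S x) _; apply: sat_agree => v _; rewrite /t /g.
case: (s v) => [[|u]|] //=; case: pselect => //= e.
by case: (cid e).
Qed.

Lemma DB_ex B I (X : countType) (R : (X + I -> U) -> Prop) :
  DB B R -> DB B (fun a => exists x, R (jn x a)).
Proof.
move=> [phi [s [F S]]].
(* Quantified coordinates become odd variables, all others even ones. Only odd variables below [N]
   can occur, so quantifying over a possibly infinite tuple takes a finite block of quantifiers. *)
pose rho v := if s v is Some (inl (inl x)) then (pickle x).*2.+1 else v.*2.
have [phi' [F' S']] := rename_formula phi rho.
pose N := (\max_(v < formula_bound phi) rho v).+1.
have rhoN v : free v phi -> rho v < N.
  move=> Fv; rewrite ltnS.
  exact: (leq_bigmax (F := fun u : 'I__ => rho u) (Ordinal (formula_boundP Fv))).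
pose l := [seq v <- iota 0 N | odd v].
have [psi [G T]] := exists_block phi' l.
pose t v := if s v./2 is Some z then
  match z with inl (inl x) => None | inl (inr i) => Some (inl i) | inr u => Some (inr u) end
  else None.
exists psi, t; split=> [v /G[Fv]|a].
  have [w Fw vE] := F' v Fv.
  rewrite mem_filter mem_iota /= add0n vE (rhoN w Fw) andbT /t /rho.
  move: (F w Fw); case E: (s w) => [[[x|i]|u]|] //=.
  - by rewrite odd_double.
  - by rewrite doubleK E.
  - by rewrite doubleK E.
have K h : sat (fun v => if v \in l then h v else oval a (t v)) phi' <->
    R (jn (fun x : X => h (pickle x).*2.+1) a).
  apply: iff_trans (S' _ _) _; apply: iff_trans (iff_sym (S _)).
  apply: sat_agree => v Fv /=.
  rewrite mem_filter mem_iota /= add0n (rhoN v Fv) andbT /t /rho.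
  move: (F v Fv); case E: (s v) => [[[x|i]|u]|] //=.
  - by rewrite odd_double.
  - by rewrite odd_double doubleK E.
  - by rewrite odd_double doubleK E.
apply: iff_trans (iff_sym (T _ _)).
split=> [[x Hx]|[h /K Hh]]; last by eexists; exact: Hh.
exists (fun v => if unpickle v./2 is Some x0 then x x0 else witness U).
apply/K; suff -> : (fun x0 : X => if unpickle (pickle x0).*2.+1./2 is Some x1 then x x1 else witness U) = x by [].
by apply/funext => x0; rewrite /= uphalf_double pickleK.
Qed.

Lemma DB_all B I (X : countType) (R : (X + I -> U) -> Prop) :
  DB B R -> DB B (fun a => forall x, R (jn x a)).
Proof.
move=> H; apply: DB_ext (DB_not (DB_ex (DB_not H))) => a.
split=> [K x|K [x]]; last exact.
by apply: contrapT => N; apply: K; exists x.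
Qed.

Lemma DB_finite_support B (R : (nat -> U) -> Prop) : DB B R ->
  exists N, forall a a', (forall i, i < N -> a i = a' i) -> R a <-> R a'.
Proof.
move=> [phi [s [F S]]].
exists (\max_(v < formula_bound phi) (if s v is Some (inl i) then i.+1 else 0)) => a a' H.
apply: iff_trans (S _) _; apply: iff_trans (iff_sym (S _)).
apply: sat_agree => v Fv; case E: (s v) => [[i|]|] //=; apply: H.
have /= := leq_bigmax (F := fun v : 'I__ => if s v is Some (inl i) then i.+1 else 0)
  (Ordinal (formula_boundP Fv)).
by rewrite E.
Qed.

End Definable.

(** * Countability of the set of definable predicates *)

Section Countable.
Variables (L : language) (ctbL : countable_language L).

Lemma term_code : exists code : term L -> GenTree.tree nat, injective code.
Proof.
have [[ef efI] _] := ctbL.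
pose fix code (t : term L) : GenTree.tree nat :=
  match t with
  | Var n => GenTree.Leaf n
  | App f args => GenTree.Node (ef f) [seq code (args i) | i <- enum 'I_(farity f)]
  end.
exists code; elim=> [n|f args IH] [m|g args'] //=; first by case=> ->.
case=> /efI E; subst g => /eq_in_map H; congr (App _).
by apply/funext => i; apply: IH; apply: H; rewrite mem_enum.
Qed.

Lemma formula_code : exists code : formula L -> GenTree.tree nat, injective code.
Proof.
have [ct ctI] := term_code; have [_ [er erI]] := ctbL.
pose fix code (p : formula L) : GenTree.tree nat :=
  match p with
  | Fals => GenTree.Leaf 0
  | Eqf t1 t2 => GenTree.Node 0 [:: ct t1; ct t2]
  | Rel r args => GenTree.Node 1 (GenTree.Leaf (er r) :: [seq ct (args i) | i <- enum 'I_(rarity r)])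
  | Imp p q => GenTree.Node 2 [:: code p; code q]
  | All v p => GenTree.Node 3 [:: GenTree.Leaf v; code p]
  end.
exists code; elim=> [|t1 t2|r args|p IHp q IHq|v p IHp]
  [|s1 s2|r' args'|p' q'|v' p'] //=.
- by case=> /ctI -> /ctI ->.
- case=> /erI E; subst r' => /eq_in_map H; congr (Rel _).
  by apply/funext => i; apply: ctI; apply: H; rewrite mem_enum.
- by case=> /IHp -> /IHq ->.
- by case=> -> /IHp ->.
Qed.

Lemma DB_enum (U : struc L) (I : countType) (e : nat -> U) :
  exists F : nat -> ((I -> U) -> Prop), forall R, DB (range e) R -> exists n, F n = R.
Proof.
have [code codeI] := formula_code.
pose val (a : I -> U) (z : option (I + nat)) : U :=
  match z with Some (inl i) => a i | Some (inr n) => e n | None => witness U end.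
(* A finite list [s] suffices, since only variables below [formula_bound phi] matter. Asking for
   some formula and list with code [n] avoids a decoding function; injectivity makes them unique. *)
exists (fun n a => exists phi s,
  pickle (code phi, s) = n /\ sat (fun v => val a (nth None s v)) phi).
move=> R [phi [t [F S]]].
pose g z : option (I + nat) :=
  match z with
  | Some (inl i) => Some (inl i)
  | Some (inr u) => match pselect (exists n, e n = u) with
                    | left E => Some (inr (projT1 (cid E))) | right _ => None end
  | None => None
  end.
pose s := [seq g (t v) | v <- iota 0 (formula_bound phi)].
exists (pickle (code phi, s)); apply/funext => a; apply/propext.
have K : sat (fun v => val a (nth None s v)) phi <-> R a.
  apply: iff_trans (iff_sym (S a)); apply: sat_agree => v Fv.
  have vb := formula_boundP Fv.
  rewrite /s (nth_map 0) ?size_iota // nth_iota // add0n /g.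
  move: (F v Fv); case: (t v) => [[i|u]|] //= [n _ nu].
  case: pselect => [E|ne] /=; first by case: (cid E).
  by case: ne; exists n.
split=> [[psi [s' [/(pcan_inj pickleK) [/codeI -> ->]]]]|/K Ra]; first by move/K.
by exists phi, s.
Qed.

End Countable.

(** * Countably saturated models *)

Definition nonprincipal_ultrafilter (W : set (set nat)) : Prop :=
  [/\ (forall A C, W A -> A `<=` C -> W C), (forall A C, W A -> W C -> W (A `&` C)),
      ~ W set0, (forall A, W A \/ W (~` A)) & (forall N, W [set n | N <= n])].

Lemma nonprincipal_ultrafilter_exists : exists W, nonprincipal_ultrafilter W.
Proof.
have [W [UW sW]] := @ultraFilterLemma nat eventually eventually_filter.
have WS : forall A C : set nat, W A -> A `<=` C -> W C by move=> A C WA sAC; apply: filterS sAC WA.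
have WI := @filterI _ W _; have W0 : ~ W set0 by exact: filter_not_empty.
exists W; split=> [//|A C|//|A|N]; [exact: WI| |by apply: sW; exists N].
have [WnA|nWnA] := pselect (W (~` A)); [by right|left].
(* This filter extends [W] and contains [A], and it is proper because the complement of [A] is not
   in [W]; maximality gives [G = W]. *)
pose G : set (set nat) := fun P => W (~` A `|` P).
have FG : ProperFilter G.
  apply: Build_ProperFilter_ex => [P GP|].
    apply: contrapT => nP; apply: nWnA; apply: WS GP _ => n [//|Pn].
    by case: nP; exists n.
  split=> [|P Q GP GQ|P Q PQ GP]; rewrite /G.
  - by rewrite setUT; apply: filterT.
  - by rewrite setUIr; apply: WI.
  - by apply: WS GP _ => n []; [left|right; apply: PQ].
have <- : G = W.
  by apply: max_filter => // P WP; apply: WS WP _ => n; right.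
by rewrite /G setUC setUv; apply: filterT.
Qed.

Section Ultrapower.
Variables (L : language) (M : struc L) (W : set (set nat)).
Hypothesis ultraW : nonprincipal_ultrafilter W.

Let WS : forall A C, W A -> A `<=` C -> W C. Proof. by case: ultraW. Qed.
Let WI : forall A C, W A -> W C -> W (A `&` C). Proof. by case: ultraW. Qed.
Let W0 : ~ W set0. Proof. by case: ultraW. Qed.
Let WU : forall A, W A \/ W (~` A). Proof. by case: ultraW. Qed.
Let WN : forall N, W [set n | N <= n]. Proof. by case: ultraW. Qed.

Let WT : W setT. Proof. exact: WS (WN 0) _. Qed.

Let W_all (n : nat) (A : 'I_n -> set nat) : (forall j, W (A j)) -> W [set i | forall j, A j i].
Proof.
move=> H; suff K m : W [set i | forall j : 'I_n, j < m -> A j i].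
  by apply: WS (K n) _ => i Hi j; apply: Hi.
elim: m => [|m IH]; first by apply: WS WT _ => i _ j; rewrite ltn0.
have [mn|nm] := ltnP m n; last first.
  by apply: WS IH _ => i Hi j _; apply: Hi; apply: leq_trans (ltn_ord j) nm.
apply: WS (WI IH (H (Ordinal mn))) _ => i [Hi Hm] j; rewrite ltnS leq_eqVlt => /orP[/eqP jm|/Hi//].
by suff -> : j = Ordinal mn by []; apply/val_inj.
Qed.

Definition eqW (f g : nat -> M) : Prop := W [set i | f i = g i].

Let eqW_eq f g : eqW f g -> eqW f = eqW g.
Proof.
move=> fg; apply/funext => h; apply/propext; rewrite /eqW.
by split=> H; apply: WS (WI fg H) _ => i /= [-> ->].
Qed.

(** Actual equivalence classes are needed because [sat] interprets [Eqf] by Rocq equality. *)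
Definition up_carrier := {P : set (nat -> M) | exists f, P = eqW f}.
Definition up_class (f : nat -> M) : up_carrier :=
  exist (fun P => exists f, P = eqW f) (eqW f) (ex_intro _ f erefl).
Definition up_rep (x : up_carrier) : nat -> M := projT1 (cid (proj2_sig x)).

Lemma up_classP f g : up_class f = up_class g <-> eqW f g.
Proof.
split=> [[E]|/eqW_eq E]; last exact: eq_exist.
rewrite -[eqW f g]/(eqW f g) E /eqW; apply: WS WT _ => i _ //.
Qed.

Lemma up_repK x : up_class (up_rep x) = x.
Proof.
case: x => P HP; apply: eq_exist; rewrite /up_rep /=.
by case: (cid HP).
Qed.

Lemma up_rep_class f : eqW (up_rep (up_class f)) f.
Proof. by apply/up_classP; rewrite up_repK. Qed.

Definition ultrapower : struc L := {|
  carrier := up_carrier;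
  witness := up_class (fun _ => witness M);
  fint := fun f args => up_class (fun i => fint M f (fun j => up_rep (args j) i));
  rint := fun r args => W [set i | rint M r (fun j => up_rep (args j) i)] |}.

Lemma eval_ultrapower (e : nat -> ultrapower) t :
  eval e t = up_class (fun i => eval (fun v => up_rep (e v) i) t).
Proof.
elim: t => [v|f args IH] /=; first by rewrite -{1}[e v]up_repK.
apply/up_classP; have := W_all (fun j => up_rep_class
  (fun i => eval (fun v => up_rep (e v) i) (args j))).
move=> H; apply: WS H _ => i /= Hi; congr (fint M f _); apply/funext => j.
by rewrite IH Hi.
Qed.

Lemma los phi (e : nat -> ultrapower) :
  sat e phi <-> W [set i | sat (fun v => up_rep (e v) i) phi].
Proof.
elim: phi e => [|t1 t2|r args|p IHp q IHq|v p IHp] e /=.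
- by split=> // H; apply: W0; apply: WS H _ => i.
- by rewrite !eval_ultrapower; exact: up_classP.
- have H := W_all (fun j => up_rep_class
    (fun i => eval (fun v => up_rep (e v) i) (args j))).
  have E i : (forall j, up_rep (up_class (fun i => eval (fun v => up_rep (e v) i) (args j))) i
      = eval (fun v => up_rep (e v) i) (args j)) ->
    (fun j => up_rep (eval e (args j)) i) = (fun j => eval (fun v => up_rep (e v) i) (args j)).
    by move=> Hi; apply/funext => j; rewrite eval_ultrapower Hi.
  by split=> K; apply: WS (WI H K) _ => i /= [/E ->].
- split=> [H|H /IHp Hp]; last first.
    by apply/IHq; apply: WS (WI H Hp) _ => i /= [K] /K.
  have [Wp|Wnp] := WU [set i | sat (fun v => up_rep (e v) i) p].
    by move/IHp/H/IHq: (Wp) => K; apply: WS K _ => i /=.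
  by apply: WS Wnp _ => i /= K /K.
- have K x i : up_rep (up_class x) i = x i -> forall w,
      up_rep (upd e v (up_class x) w) i = upd (fun w => up_rep (e w) i) v (x i) w.
    by move=> E w; rewrite /upd; case: eqP.
  split=> [H|H x]; last first.
    apply/IHp; rewrite -[x]up_repK; apply: WS (WI H (up_rep_class (up_rep x))) _ => i /= [Hi E].
    by apply: sat_agree1 (Hi (up_rep x i)) => w _; rewrite (K _ _ E).
  have [//|Wn] := WU [set i | forall x, sat (upd (fun w => up_rep (e w) i) v x) p].
  pose x i : M := match pselect (exists x, ~ sat (upd (fun w => up_rep (e w) i) v x) p) with
    | left E => projT1 (cid E) | right _ => witness M end.
  have Hx := proj1 (IHp _) (H (up_class x)).
  case: W0; apply: WS (WI (WI Wn Hx) (up_rep_class x)) _ => i /= [[N Hi] E].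
  case: N => y; apply: contrapT => Hy.
  have : ~ sat (upd (fun w => up_rep (e w) i) v (x i)) p.
    by rewrite /x; case: pselect => [Q|[]]; [case: (cid Q)|exists y].
  by apply; apply: sat_agree1 Hi => w _; rewrite (K _ _ E).
Qed.

Lemma ultrapower_model (T : theory L) : is_model T M -> is_model T ultrapower.
Proof. by move=> HM phi /HM H e; apply/los; apply: WS WT _ => i _; apply: H. Qed.

Lemma ultrapower_saturated (I : Type) (F : nat -> (I -> ultrapower) -> Prop) :
  (forall n, DB setT (F n)) -> (forall n, exists a, forall m, m < n -> F m a) ->
  exists a, forall n, F n a.
Proof.
move=> DF SF.
have [phi Dphi] := choice DF; have [s Hs] := choice Dphi.
pose val (i : nat) (a : I -> M) (z : option (I + ultrapower)) : M :=
  match z with Some (inl j) => a j | Some (inr u) => up_rep u i | None => witness M end.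
pose G i n (a : I -> M) := forall m, m < n -> sat (fun v => val i a (s m v)) (phi m).
have G_los m (a : I -> ultrapower) :
    F m a <-> W [set i | sat (fun v => val i (fun j => up_rep (a j) i) (s m v)) (phi m)].
  have [Fm Sm] := Hs m; apply: iff_trans (Sm a) _; apply: iff_trans (los _ _) _.
  have E i : sat (fun v => up_rep (oval a (s m v)) i) (phi m) <->
      sat (fun v => val i (fun j => up_rep (a j) i) (s m v)) (phi m).
    by apply: sat_agree => v /Fm; case: (s m v) => [[]|].
  by split=> H; apply: WS H _ => i /= /E.
have GW n : W [set i | exists a, G i n a].
  have [a Ha] := SF n.
  have := W_all (fun m : 'I_n => proj1 (G_los m a) (Ha m (ltn_ord m))).
  move=> H; apply: WS H _ => i /= Hi; exists (fun j => up_rep (a j) i) => m mn.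
  exact: (Hi (Ordinal mn)).
(* Diagonal choice: in coordinate [i], one tuple solves the longest solvable initial segment of
   length at most [i]. The cut-off guarantees that a longest one exists. *)
have Ga i : exists a, forall n, n <= i -> (exists a', G i n a') -> G i n a.
  suff K k : exists a, forall n, n <= k -> (exists a', G i n a') -> G i n a by exact: K i.
  elim: k => [|k [a Ha]].
    by exists (fun _ => witness M) => n; rewrite leqn0 => /eqP -> _ m; rewrite ltn0.
  have [[a' Ga']|ne] := pselect (exists a', G i k.+1 a').
    by exists a' => n nk _ m mn; apply: Ga'; apply: leq_trans mn nk.
  by exists a => n; rewrite leq_eqVlt => /orP[/eqP -> /ne//|]; rewrite ltnS; exact: Ha.
have [a Ha] := choice Ga.
exists (fun j => up_class (fun i => a i j)) => m; apply/G_los.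
have [Fm Sm] := Hs m.
have R : W [set i | forall v : 'I_(formula_bound (phi m)), forall j, s m v = Some (inl j) ->
    up_rep (up_class (fun i => a i j)) i = a i j].
  apply: W_all => v; case E: (s m v) => [[j|u]|].
  - by apply: WS (up_rep_class (fun i => a i j)) _ => i /= Hi j' [<-].
  - by apply: WS WT _.
  - by apply: WS WT _.
apply: WS (WI (WI (GW m.+1) (WN m.+1)) R) _ => i /= [[Hi mi] Ri].
have K : sat (fun v => val i (a i) (s m v)) (phi m) by apply: (Ha i m.+1).
apply: sat_agree1 K => v Fv.
have := Ri (Ordinal (formula_boundP Fv)) => /=.
by case: (s m v) => [[j|u]|] //= ->.
Qed.

End Ultrapower.

(* [compact U] is countable saturation, for types in countably many variables at once. *)
Definition ctbl (U : Type) (B : set U) : Prop := exists e : nat -> U, B `<=` range e.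

Definition compact L (U : struc L) : Prop :=
  forall (I : countType) (B : set U) (G : ((I -> U) -> Prop) -> Prop),
    ctbl B -> (forall R, G R -> DB B R) ->
    (forall l : list ((I -> U) -> Prop), (forall R, In R l -> G R) ->
       exists a, forall R, In R l -> R a) ->
    exists a, forall R, G R -> R a.

Lemma compact_model_exists L (T : theory L) : countable_language L ->
  (exists M : struc L, is_model T M) -> exists U : struc L, is_model T U /\ compact U.
Proof.
move=> ctbL [M HM]; have [W UW] := nonprincipal_ultrafilter_exists.
exists (ultrapower M W); split; first exact: ultrapower_model.
move=> I B G [e Be] GD GS.
have [F HF] := DB_enum ctbL I e.
pose F' n := if pselect (G (F n)) then F n else (fun _ => True).
have [] := @ultrapower_saturated L M W UW I F'.
- move=> n; rewrite /F'; case: pselect => [Gn|nG]; first exact: DB_mono (@subsetT _ _) (GD _ Gn).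
  exact: DB_const.
- move=> n; pose l := [seq F m | m <- iota 0 n & asbool (G (F m))].
  have [R|a Ha] := GS l.
    rewrite /l; elim: (iota 0 n) => //= m s IH; case: asboolP => //= Gm [<- //|]; exact: IH.
  exists a => m mn; rewrite /F'; case: pselect => // Gm; apply: Ha.
  have : m \in iota 0 n by rewrite mem_iota.
  rewrite /l; elim: (iota 0 n) => //= k s IH; rewrite in_cons => /orP[/eqP <-|/IH H].
    by case: asboolP => // _; left.
  by case: ifP => // _; right.
move=> a Ha; exists a => R GR.
have [n nR] := HF R (DB_mono Be (GD R GR)).
rewrite -nR in GR *; by move: (Ha n); rewrite /F'; case: pselect => [Gn|[]].
Qed.

(** * Types and dividing *)

Lemma ctblU (U : Type) (B C : set U) : ctbl B -> ctbl C -> ctbl (B `|` C).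
Proof.
move=> [e He] [f Hf]; exists (fun n => if odd n then e n./2 else f n./2) => u [/He|/Hf] [n _ <-].
  by exists n.*2.+1 => //=; rewrite odd_double /= uphalf_double.
by exists n.*2 => //=; rewrite odd_double doubleK.
Qed.

Lemma ctbl0 (L : language) (U : struc L) : ctbl (@set0 U).
Proof. by exists (fun _ => witness U). Qed.

Lemma ctbl_sub (U : Type) (B C : set U) : B `<=` C -> ctbl C -> ctbl B.
Proof. by move=> BC [e He]; exists e => u /BC/He. Qed.

Lemma ctbl_range (L : language) (U : struc L) (I : countType) (a : I -> U) : ctbl (range a).
Proof.
exists (fun n => if unpickle n is Some i then a i else witness U) => _ [i _ <-].
by exists (pickle i) => //; rewrite pickleK.
Qed.

Lemma list_choice (X Y : Type) (P : X -> Y -> Prop) (l : list X) :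
  (forall x, In x l -> exists y, P x y) ->
  exists l', (forall y, In y l' -> exists2 x, In x l & P x y) /\
    (forall x, In x l -> exists2 y, In y l' & P x y).
Proof.
elim: l => [|x l IH] H; first by exists nil; split.
have [|l' [H1 H2]] := IH; first by move=> z zl; apply: H; right.
have [y xy] := H x (or_introl erefl).
exists (y :: l')%list; split=> [z [<-|/H1[w wl wz]]|z [<-|/H2[w wl wz]]].
- by exists x => //; left.
- by exists w => //; right.
- by exists y => //; left.
- by exists w => //; right.
Qed.

Section Types.
Variables (L : language) (U : struc L).
Implicit Types (B C D : set U).

Definition eqs B (I : Type) (a a' : I -> U) : Prop := forall R, DB B R -> R a -> R a'.

Lemma eqs_sym B I (a a' : I -> U) : eqs B a a' -> eqs B a' a.
Proof. by move=> H R DR Ra'; apply: contrapT => /(H _ (DB_not DR)). Qed.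

Lemma eqs_trans B I (a a' a'' : I -> U) : eqs B a a' -> eqs B a' a'' -> eqs B a a''.
Proof. by move=> H H' R DR /H/H'; apply. Qed.

Lemma eqs_mono B C I (a a' : I -> U) : B `<=` C -> eqs C a a' -> eqs B a a'.
Proof. by move=> BC H R DR; apply: H; apply: DB_mono DR. Qed.

Lemma eqs_reind B I J (r : I -> J) (a a' : J -> U) :
  eqs B a a' -> eqs B (a \o r) (a' \o r).
Proof. by move=> H R DR; apply: (H (fun a => R (a \o r))); apply: DB_reind. Qed.

Lemma eqs_jnl B I J (a a' : I -> U) (b b' : J -> U) : eqs B (jn a b) (jn a' b') -> eqs B a a'.
Proof. exact: (@eqs_reind B _ _ inl). Qed.

Lemma eqs_jnr B I J (a a' : I -> U) (b b' : J -> U) : eqs B (jn a b) (jn a' b') -> eqs B b b'.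
Proof. exact: (@eqs_reind B _ _ inr). Qed.

Definition swap (I J : Type) (k : I + J) : J + I :=
  match k with inl i => inr i | inr j => inl j end.

Lemma jn_swap I J (a : I -> U) (b : J -> U) : jn b a \o @swap I J = jn a b.
Proof. by apply/funext => -[]. Qed.

Lemma eqs_swap B I J (a a' : I -> U) (b b' : J -> U) :
  eqs B (jn a b) (jn a' b') -> eqs B (jn b a) (jn b' a').
Proof. by move=> /(@eqs_reind B _ _ (@swap J I)); rewrite !jn_swap. Qed.

Lemma eqs_ext B I K (a a' : I -> U) (h : K -> U) :
  eqs (B `|` range h) a a' <-> eqs B (jn a h) (jn a' h).
Proof.
split=> H R DR.
  apply: (H (fun x => R (jn x h))); apply: DB_spec; first exact: subsetUr.
  by apply: DB_mono DR; exact: subsetUl.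
have [R' [DR' E]] := DB_abs DR.
by move/E => Ra; apply/E; apply: H.
Qed.

Section Compactness.
Hypothesis cU : compact U.

(* To realize a type over [p] it is enough to realize its finite parts over tuples with approximately the type of [p]. *)
Lemma compact_over (I K : countType) B (p : K -> U) (G : ((I + K -> U) -> Prop) -> Prop) :
  ctbl B -> (forall R, G R -> DB B R) ->
  (forall l S, (forall R, In R l -> G R) -> DB B S -> S p ->
    exists u p', S p' /\ forall R, In R l -> R (jn u p')) ->
  exists u, forall R, G R -> R (jn u p).
Proof.
move=> cB GD GS.
pose G' (Q : (I -> U) -> Prop) := exists2 R, G R & Q = (fun u => R (jn u p)).
have [] := @cU I (B `|` range p) G'.
- by apply: ctblU cB _; apply: ctbl_range.
- move=> _ [R GR ->]; apply: DB_spec; first exact: subsetUr.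
  by apply: DB_mono (GD R GR); exact: subsetUl.
- move=> l lG.
  have [|l' [H1 H2]] := @list_choice _ _ (fun Q R => G R /\ Q = (fun u => R (jn u p))) l.
    by move=> Q /lG [R GR ->]; exists R.
  have l'G R : In R l' -> G R by move=> /H1 [Q _ []].
  apply: contrapT => N.
  have DN : DB B (fun p' : K -> U => ~ exists u, forall R, In R l' -> R (jn u p')).
    apply: DB_not; apply: (@DB_ex _ _ B K I (fun z => forall R, In R l' -> R z)).
    by apply: DB_all_list => R /l'G/GD.
  have [|u [p' [Np' Hu]]] := GS l' _ l'G DN; last by apply: Np'; exists u.
  move=> [u Hu]; apply: N; exists u => Q /H2[R Rl' [_ ->]]; exact: Hu.
move=> u Hu; exists u => R GR; apply: (Hu (fun u => R (jn u p))).
by exists R.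
Qed.

Lemma homogeneous (I J : countType) B (b b' : J -> U) (a : I -> U) :
  ctbl B -> eqs B b b' -> exists a', eqs B (jn a b) (jn a' b').
Proof.
move=> cB bb'.
have [|l S lG DS Sb'|a' Ha'] := @compact_over I J B b' (fun R => DB B R /\ R (jn a b)) cB.
- by move=> R [].
- by exists a, b; split; [exact: (eqs_sym bb')|move=> R /lG []].
- by exists a' => R DR Rab; apply: Ha'.
Qed.

Lemma homogeneousl (I J : countType) B (b b' : J -> U) (a : I -> U) :
  ctbl B -> eqs B b b' -> exists a', eqs B (jn b a) (jn b' a').
Proof.
move=> cB /(homogeneous a cB) [a' H]; exists a'; exact: eqs_swap.
Qed.

End Compactness.

Definition kinc (k : nat) (X J : Type) (R : (X + J -> U) -> Prop) (bs : nat -> J -> U) : Prop :=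
  forall s : seq nat, uniq s -> size s = k -> ~ exists x, forall t, t \in s -> R (jn x (bs t)).

(** The terms need only be conjugate to [b], and [b] itself need not occur, so the notion depends
    only on the type of [b] over [B]. The constant [k] stays explicit because a fixed [k] is what
    compactness preserves. *)
Definition dvd B (X J : Type) (R : (X + J -> U) -> Prop) (b : J -> U) (k : nat) : Prop :=
  exists bs, (forall t, eqs B b (bs t)) /\ kinc k R bs.

(* [nd B a b]: the type of [a] over [B] and [b] contains no formula that divides over [B]. *)
Definition nd B (I J : Type) (a : I -> U) (b : J -> U) : Prop :=
  forall R, DB B R -> R (jn a b) -> forall k, ~ dvd B R b k.

(* For [C] the range of a tuple [a], this is [nd B a b] again, in a form that makes left transitivity trivial. *)
Definition Ind B C (J : Type) (b : J -> U) : Prop :=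
  forall (X : countType) (R : (X + J -> U) -> Prop) k,
    DB B R -> dvd B R b k -> dvd (B `|` C) R b k.

Definition row (J : Type) (w : nat * J -> U) (t : nat) : J -> U := fun j => w (t, j).
Definition unrow (J : Type) (bs : nat -> J -> U) : nat * J -> U := fun q => bs q.1 q.2.

Lemma DB_kinc B (X : countType) J (R : (X + J -> U) -> Prop) (s : seq nat) :
  DB B R -> DB B (fun w : nat * J -> U => ~ exists x, forall t, t \in s -> R (jn x (row w t))).
Proof.
move=> DR; apply: DB_not.
apply: (@DB_ex _ _ B (nat * J)%type X (fun z => forall t, t \in s ->
  R (jn (z \o inl) (row (z \o inr) t)))).
apply: DB_all_in => t _.
pose r (k : X + J) : X + nat * J := match k with inl x => inl x | inr j => inr (t, j) end.
apply: DB_ext (DB_reind r DR) => z.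
suff -> : z \o r = jn (z \o inl) (row (z \o inr) t) by [].
by apply/funext => -[].
Qed.

Lemma dvd_anti B C X J (R : (X + J -> U) -> Prop) b k : C `<=` B -> dvd B R b k -> dvd C R b k.
Proof. by move=> CB [bs [H K]]; exists bs; split=> // t; apply: eqs_mono (H t). Qed.

Lemma dvd_conj B X J (R : (X + J -> U) -> Prop) b b' k :
  eqs B b b' -> dvd B R b k -> dvd B R b' k.
Proof.
move=> E [bs [H K]]; exists bs; split=> // t; apply: eqs_trans (H t); exact: eqs_sym.
Qed.

Lemma Ind_sub B C D J (b : J -> U) : D `<=` C -> Ind B C b -> Ind B D b.
Proof. by move=> DC H X R k DR /H - /(_ DR); apply: dvd_anti; apply: setUS. Qed.

Lemma Ind_trans B C D J (b : J -> U) : Ind B C b -> Ind (B `|` C) D b -> Ind B (C `|` D) b.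
Proof.
move=> H1 H2 X R k DR Hd; rewrite setUA; apply: H2; last exact: H1.
by apply: DB_mono DR; exact: subsetUl.
Qed.

Lemma Ind_nd B (I : countType) J (a : I -> U) (b : J -> U) : Ind B (range a) b -> nd B a b.
Proof.
move=> H R DR Rab k /(H _ _ _ DR) [bs [Hb K]].
apply: (K (iota 0 k)); rewrite ?iota_uniq ?size_iota //.
exists a => t _; have := Hb t; move/eqs_ext/eqs_swap; exact.
Qed.

Lemma nd_conj B I J (a a' : I -> U) (b b' : J -> U) :
  eqs B (jn a b) (jn a' b') -> nd B a b -> nd B a' b'.
Proof.
move=> E H R DR Rab' k D; apply: (H R DR _ k); first exact: (eqs_sym E).
by apply: dvd_conj D; apply: eqs_sym; apply: eqs_jnr E.
Qed.

Lemma range_sub_reind I J (a : I -> U) (b : J -> U) :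
  range a `<=` range b -> exists r, a = b \o r.
Proof.
move=> H; have H' i : exists j, b j = a i by have [|j _ E] := H (a i); [exists i|exists j].
by have [r Hr] := choice H'; exists r; apply/funext => i; rewrite /= Hr.
Qed.

Lemma nd_subl B I I' J (a : I -> U) (a' : I' -> U) (b : J -> U) :
  range a' `<=` range a -> nd B a b -> nd B a' b.
Proof.
move=> /range_sub_reind [r ->] H R DR Rab k [bs [Hb K]].
pose r' (z : I' + J) : I + J := match z with inl i => inl (r i) | inr j => inr j end.
have E x y : jn x y \o r' = jn (x \o r) y by apply/funext => -[].
apply: (H (fun z => R (z \o r')) (DB_reind r' DR) _ k); first by rewrite E.
exists bs; split=> // s us sk [x Hx]; apply: (K s us sk); exists (x \o r) => t /Hx.
by rewrite E.
Qed.

(** Parameters from [c] become coordinates, and a dividing sequence over [B] and [c] remains one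
    over [B] when the constant tuple [c] is adjoined to each term. *)
Lemma nd_base B I J K (a : I -> U) (b : J -> U) (c : K -> U) :
  nd B a (jn b c) -> nd (B `|` range c) a b.
Proof.
move=> H R /DB_abs [R' [DR' E]] Rab k [bs [Hb Kb]].
pose r (z : (I + J) + K) : I + (J + K) :=
  match z with inl (inl i) => inl i | inl (inr j) => inr (inl j) | inr l => inr (inr l) end.
have Er x y : jn x (jn y c) \o r = jn (jn x y) c by apply/funext => -[[]|].
apply: (H (fun z => R' (z \o r)) (DB_reind r DR') _ k); first by rewrite Er; apply/E.
exists (fun t => jn (bs t) c); split=> [t|s us sk [x Hx]]; first exact/eqs_ext.
by apply: (Kb s us sk); exists x => t /Hx; rewrite Er => /E.
Qed.

Section Compact2.
Hypothesis cU : compact U.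

(** Unlike on the left, saturation is used: each conjugate of the subtuple [b'] must be completed to
    a conjugate of all of [b]. *)
Lemma nd_sub B I (J J' : countType) (a : I -> U) (b : J -> U) (b' : J' -> U) : ctbl B ->
  range b' `<=` range b -> nd B a b -> nd B a b'.
Proof.
move=> cB /range_sub_reind [r ->] H R DR Rab k [bs [Hb K]].
pose r' (z : I + J') : I + J := match z with inl i => inl i | inr j => inr (r j) end.
have E x y : jn x y \o r' = jn x (y \o r) by apply/funext => -[].
have [cs Hcs] := choice (fun t => homogeneousl cU b cB (Hb t)).
have csr t : cs t \o r = bs t.
  apply/funext => j.
  exact: (Hcs t _ (DB_eq B (inr (r j) : J' + J) (inl j)) erefl).
apply: (H (fun z => R (z \o r')) (DB_reind r' DR) _ k); first by rewrite E.
exists cs; split=> [t|s us sk [x Hx]]; first exact: eqs_jnr (Hcs t).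
by apply: (K s us sk); exists x => t /Hx; rewrite E csr.
Qed.

(** A sequence of conjugates of [b] over [B] and [a] is sought by compactness. If a finite part
    concerning [n] terms failed, the conjunction [Q] of its conditions, true of [a] and [b], would
    be [n]-inconsistent along [bs], so it would divide at [b]. Being [k]-inconsistent for [R] is
    inherited by any choice of distinct terms of [bs]. *)
Lemma nd_Ind B (I J : countType) (a : I -> U) (b : J -> U) : ctbl B ->
  nd B a b -> Ind B (range a) b.
Proof.
move=> cB H X R k DR [bs [Hb Kb]].
pose rowr i (z : nat * J + I -> U) : J + I -> U := jn (row (z \o inl) i) (z \o inr).
have DBrow i S : DB B S -> DB B (fun z => S (rowr i z)).
  move=> DS; pose r (z : J + I) : nat * J + I :=
    match z with inl j => inl (i, j) | inr l => inr l end.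
  apply: DB_ext (DB_reind r DS) => z; suff -> : z \o r = rowr i z by [].
  by apply/funext => -[].
pose G (Q : (nat * J + I -> U) -> Prop) :=
  (exists i S, [/\ DB B S, S (jn b a) & Q = (fun z => S (rowr i z))]) \/
  (exists s : seq nat, [/\ uniq s, size s = k &
    Q = (fun z => ~ exists x, forall t, t \in s -> R (jn x (row (z \o inl) t)))]).
have [] := @compact_over cU _ _ B a G cB.
- move=> Q [[i [S [DS _ ->]]]|[s [_ _ ->]]]; first exact: DBrow.
  exact: (DB_reind inl (DB_kinc s DR)).
- move=> l S lG DS Sa.
  (* [n] bounds the rows that the finite part mentions, and [S'] collects the conditions imposed on
     any of them. *)
  have [n [S' [DS' S'ba HS']]] : exists n S', [/\ DB B S', S' (jn b a) &
      forall z : nat * J + I -> U, (forall i, i < n -> S' (rowr i z)) ->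
      (forall s : seq nat, uniq s -> size s = k -> (forall t, t \in s -> t < n) ->
        ~ exists x, forall t, t \in s -> R (jn x (row (z \o inl) t))) ->
      forall Q, In Q l -> Q z].
    elim: l lG => [|Q l IH] lG.
      by exists 0, (fun _ => True); split=> //; exact: DB_const.
    have [|n [S' [DS' S'ba HS']]] := IH; first by move=> P Pl; apply: lG; right.
    have [[i [S1 [DS1 S1ba QE]]]|[s [us sk QE]]] := lG Q (or_introl erefl).
      exists (maxn i.+1 n), (fun z => S' z /\ S1 z); split=> [|//|z Hz Kz P [<-|Pl]].
      - exact: DB_and.
      - by rewrite QE; have [|_] := Hz i; rewrite ?leq_max ?leqnn.
      - apply: (HS' z) => // [j jn|s us sk sn].
          by have [|] := Hz j; rewrite ?leq_max ?jn ?orbT.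
        by apply: Kz => // t /sn tn; rewrite leq_max tn orbT.
    exists (maxn (\max_(t <- s) t).+1 n), S'; split=> // z Hz Kz P [<-|Pl].
      rewrite QE; apply: Kz => // t ts; rewrite leq_max ltnS.
      by rewrite (@leq_bigmax_seq _ _ _ id).
    apply: (HS' z) => // [j jn|s' us' sk' sn].
      by apply: Hz; rewrite leq_max jn orbT.
    by apply: Kz => // t /sn tn; rewrite leq_max tn orbT.
  pose Q (z : I + J -> U) := S' (jn (z \o inr) (z \o inl)) /\ S (z \o inl).
  have DQ : DB B Q.
    apply: DB_and; last exact: DB_reind.
    apply: DB_ext (DB_reind (@swap J I) DS') => z.
    suff -> : z \o @swap J I = jn (z \o inr) (z \o inl) by [].
    by apply/funext => -[].
  apply: contrapT => NE; apply: (H Q DQ (conj S'ba Sa) n).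
  exists bs; split=> // s us sn [x Hx]; apply: NE.
  have ns i : i < n -> nth 0 s i \in s by move=> ni; rewrite mem_nth ?sn.
  (* If no row is constrained, [a] itself serves. Otherwise the common solution [x] replaces [a],
     and [S x] is read off the first chosen term. *)
  have [n0|n0] := posnP n.
    exists (unrow bs), a; split=> //; apply: HS' => [i|s' us' sk' sn']; first by rewrite n0.
    exact: Kb.
  exists (unrow (fun i => bs (nth 0 s i))), x; split; first by have [] := Hx _ (ns 0 n0).
  apply: HS' => [i /ns/Hx[]//|s' us' sk' sn' [y Hy]].
  apply: (Kb (map (nth 0 s) s')); last first.
  + by exists y => _ /mapP[t ts' ->]; apply: Hy.
  + by rewrite size_map.
  + rewrite map_inj_in_uniq // => i j /sn' Hi /sn' Hj /eqP.
    by rewrite nth_uniq ?sn // => /eqP.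
move=> w Hw; exists (row w); split=> [t|s us sk].
  apply/eqs_ext => S DS Sba.
  have := Hw (fun z => S (rowr t z)); apply; left; by exists t, S.
by apply: (Hw (fun z => ~ exists x, forall t, t \in s -> R (jn x (row (z \o inl) t)))); right; exists s.
Qed.

End Compact2.
End Types.
Arguments eqs_reind {L U B I J} r {a a'}.

(** * Local character *)

Definition local_character (L : language) (U : struc L) : Prop :=
  forall (B : U -> Prop) (n : nat) (a : nat -> U),
    exists l : list U, (forall x, In x l -> B x) /\ ~ forks B n a (fun x => In x l).

Section LocalCharacter.
Variables (L : language) (U : struc L).
Hypotheses (cU : compact U) (lcU : local_character U).
Implicit Types (B C D : set U).

(** Needed to meet [forks], where the type implies the instance at term [0] of the sequence. *)
Lemma dvd_start B (X J : countType) (R : (X + J -> U) -> Prop) b k :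
  ctbl B -> DB B R -> dvd B R b k ->
  exists bs, [/\ bs 0 = b, forall t, eqs B b (bs t) & kinc k R bs].
Proof.
move=> cB DR [bs [Hb Kb]].
have [w Hw] := homogeneous cU (unrow bs) cB (eqs_sym (Hb 0)).
have Dr t (S : (J + J -> U) -> Prop) : DB B S -> DB B (fun z : nat * J + J -> U =>
    S (jn (z \o inr) (row (z \o inl) t))).
  move=> DS; pose r (z : J + J) : nat * J + J :=
    match z with inl j => inr j | inr j => inl (t, j) end.
  apply: DB_ext (DB_reind r DS) => z.
  suff -> : z \o r = jn (z \o inr) (row (z \o inl) t) by [].
  by apply/funext => -[].
exists (row w); split=> [|t S DS Sb|s us sk].
- apply/funext => j.
  exact: (Hw _ (Dr 0 _ (DB_eq B (inr j : J + J) (inl j))) erefl).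
- have DI : DB B (fun z : J + J -> U => S (z \o inl) -> S (z \o inr)).
    by apply: DB_imp; exact: DB_reind.
  apply: (Hw _ (Dr t _ DI)) Sb; rewrite /= => Sb0.
  by apply: (Hb t) => //; apply: (eqs_sym (Hb 0)).
- apply: (Hw (fun z => ~ exists x, forall t, t \in s -> R (jn x (row (z \o inl) t)))).
    exact: (DB_reind inl (DB_kinc s DR)).
  exact: Kb.
Qed.

(** [DB] does not restrict [s] off the free variables. Clearing it there puts every named parameter
    into [B], so that all of them can be listed in one tuple. *)
Lemma DB_norm B I (R : (I -> U) -> Prop) : DB B R -> exists phi s,
  [/\ forall v, free v phi -> s v <> None, forall v u, s v = Some (inr u) -> B u &
   forall a, R a <-> sat (fun v => oval a (s v)) phi].
Proof.
move=> [phi [s [F S]]].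
exists phi, (fun v => if asbool (free v phi) then s v else None); split=> [v Fv|v u|a].
- by rewrite asboolT //; have := F v Fv; case: (s v).
- by case: asboolP => // Fv E; have := F v Fv; rewrite E.
- apply: iff_trans (S a) _; apply: sat_agree => v Fv.
  by rewrite asboolT.
Qed.

Definition upto (J : Type) (g : nat -> J -> U) (i : nat) : set U :=
  [set u | exists2 j, j < i & range (g j) u].

Lemma upto_mono J (g : nat -> J -> U) i j : i <= j -> upto g i `<=` upto g j.
Proof. by move=> ij u [m mi Hm]; exists m => //; apply: leq_trans mi ij. Qed.

(** The finite base [l] provided by local character for the type of [y] over everything lies in [B]
    together with [upto g i] for some [i]. The formula that divides over this larger set at [g i]
    also divides over [l]. What remains is translating [dvd] into [forks]. *)
Lemma no_dividing_chain (I : finType) (J : countType) B (y : I -> U) (g : nat -> J -> U) :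
  ctbl B ->
  ~ forall i, exists (R : (I + J -> U) -> Prop) k, [/\ DB (B `|` upto g i) R,
      R (jn y (g i)) & dvd (B `|` upto g i) R (g i) k].
Proof.
move=> cB H.
pose n := #|I|.
pose a v : U := if insub v is Some o then y (enum_val (o : 'I_n)) else witness U.
have aE i : a (enum_rank i) = y i by rewrite /a valK enum_rankK.
have [l [lB nf]] := lcU (fun u => B u \/ exists i, upto g i u) n a.
have [i Hi] : exists i, forall u, In u l -> (B `|` upto g i) u.
  elim: l lB {nf} => [|u l IH] lB; first by exists 0.
  have [|i Hi] := IH; first by move=> x xl; apply: lB; right.
  have [Bu|[j Hj]] := lB u (or_introl erefl).
    by exists i => x [<-|/Hi//]; left.
  exists (maxn i j) => x [<-|/Hi[|K]]; [right|by left|right].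
    by apply: upto_mono Hj; exact: leq_maxr.
  by apply: upto_mono K; exact: leq_maxl.
have cBi : ctbl (B `|` upto g i).
  apply: ctblU cB _; apply: ctbl_sub (ctbl_range (unrow g)) => u [j _ [c _ <-]].
  by exists (j, c).
have [R [k [DR Ry /(dvd_start cBi DR) [bs [b0 Hb Kb]]]]] := H i.
have [phi [s [F Bs S]]] := DB_norm DR.
apply: nf; exists U, id; split; first by [].
pose m := formula_bound phi.
pose rho v := if s v is Some (inl (inl x)) then nat_of_ord (enum_rank x) else n + v.
have [phi' [F' S']] := rename_formula phi rho.
have [dum Hdum] : exists dum : (J -> U) -> U, (J -> False) \/ exists j, forall b, dum b = b j.
  have [[j _]|nJ] := lem (exists j : J, True); first by exists (fun b => b j); right; exists j.
  by exists (fun _ => witness U); left => j; apply: nJ; exists j.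
(* [forks] allows no parameters in the formula besides the dividing tuple, so the parameters of [R]
   travel in the same tuple as [b]. *)
pose cc (b : J -> U) v : U := match s v with
  | Some (inl (inr j)) => b j | Some (inr u) => u | _ => dum b end.
have E x b : sat (tcat n x (cc b)) phi' <-> R (jn (fun i => x (enum_rank i)) b).
  apply: iff_trans (S' _ _) _; apply: iff_trans (iff_sym (S _)).
  apply: sat_agree => v /F; rewrite /tcat /rho /cc /=; case Es: (s v) => [[[z|j]|u]|] //= _.
  - by rewrite ltn_ord.
  - by rewrite ltnNge leq_addr /= addKn Es.
  - by rewrite ltnNge leq_addr /= addKn Es.
exists m, phi', (fun t => cc (bs t)); split; last split; last split.
- move=> v /F'[w /formula_boundP wm ->]; rewrite /rho.
  case: (s w) => [[[z|j]|u]|] /=; rewrite ?ltn_add2l //.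
  by apply: leq_trans (ltn_ord _) (leq_addr _ _).
- move=> N' h _ a' Ha'.
  apply/(Ha' phi' (cc (bs 0))); last first.
    by apply/E; rewrite b0; move: Ry; congr (R (jn _ _)); apply/funext => x; rewrite aE.
  move=> v /F'[w Fw]; rewrite /rho /cc; move: (F w Fw); case Es: (s w) => [[[z|j]|u]|] //= _.
  - by move=> E1; have := ltn_ord (enum_rank z); rewrite -E1 ltnNge leq_addr.
  - by move=> /addnI ->; rewrite Es b0; right; exists i.+1, i => //; exists j.
  - by move=> /addnI ->; rewrite Es; have [|Ku] := Bs w u Es; [left|right; exists i].
- move=> t psi e He.
  case: Hdum => [nJ|[j0 Hd]].
    by suff -> : bs t = bs 0 by []; apply/funext => j; case: (nJ j).
  pose s' v : option (J + U) := if v < m then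
      match s v with Some (inl (inr j)) => Some (inl j) | Some (inr u) => Some (inr u)
      | _ => Some (inl j0) end
    else if asbool (free v psi) then Some (inr (e (v - m))) else None.
  have K b : sat (tcat m (cc b) e) psi <-> sat (fun v => oval b (s' v)) psi.
    apply: sat_agree => v Fv; rewrite /tcat /s' /cc asboolT //.
    by case: (v < m) => //; case: (s v) => [[[]|]|] //= *; rewrite Hd.
  have DK : DB (B `|` upto g i) (fun b => sat (fun v => oval b (s' v)) psi).
    exists psi, s'; split=> // v Fv; rewrite /s' asboolT //.
    case: ltnP => vm; first by case Es: (s v) => [[[]|u]|] //=; exact: Bs Es.
    by apply: Hi; have [|x [xl ->]] := He (v - m); rewrite ?subnKC.
  apply: iff_trans (K _) _; apply: iff_trans (iff_sym (K _)).
  have E0 : eqs (B `|` upto g i) (bs t) (bs 0).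
    by rewrite b0; apply: eqs_sym.
  by split; [exact: (E0 _ DK)|exact: (eqs_sym E0 DK)].
- exists k => q qI [x Hx].
  apply: (Kb [seq q j | j <- enum 'I_k]).
  + by rewrite map_inj_uniq // enum_uniq.
  + by rewrite size_map size_enum_ord.
  + exists (fun i => x (enum_rank i)) => _ /mapP[j _ ->]; exact/E.
Qed.

End LocalCharacter.

(** * Dividing chains *)

Lemma range_jn (I J U : Type) (a : I -> U) (b : J -> U) : range (jn a b) = range a `|` range b.
Proof.
apply/seteqP; split=> u [].
  by case=> [i|j] _ <-; [left; exists i|right; exists j].
by case=> i _ <-; exists (inl i).
by case=> j _ <-; exists (inr j).
Qed.

Lemma increasing_inj (sigma : nat -> nat) : (forall n, sigma n < sigma n.+1) -> injective sigma.
Proof.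
move=> sS i j E; have H := homo_ltn ltn_trans sS.
by case: (ltngtP i j) => [/H|/H|//]; rewrite E ltnn.
Qed.

Lemma seq_build (X : Type) (P : seq X -> X -> Prop) :
  (forall s, exists x, P s x) -> exists g : nat -> X, forall n, P (mkseq g n) (g n).
Proof.
move=> /choice [F HF].
pose fix s n := if n is n'.+1 then rcons (s n') (F (s n')) else [::].
exists (fun n => F (s n)) => n; suff -> : mkseq (fun n => F (s n)) n = s n by [].
by elim: n => //= n IH; rewrite mkseqS IH.
Qed.

Lemma DB_exists_in L (U : struc L) (B : set U) (I : Type) (T : Type) (R : T -> (I -> U) -> Prop) (l : list T) :
  (forall t, In t l -> DB B (R t)) -> DB B (fun a => exists2 t, In t l & R t a).
Proof.
elim: l => [|t l IH] H; first by apply: DB_ext (DB_const B I False) => a; split=> [//|[]].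
have H1 := DB_not (H t (or_introl erefl)).
have H2 := IH (fun u i => H u (or_intror i)).
apply: DB_ext (DB_imp H1 H2) => a; split=> [K|[u [<-|ul] Hu] nt].
- have [Rt|/K [u ul Ru]] := lem (R t a); first by exists t => //; left.
  by exists u => //; right.
- by [].
- by exists u.
Qed.

Section Chains.
Variables (L : language) (U : struc L).
Hypotheses (cU : compact U) (lcU : local_character U).
Implicit Types (B C D : set U).

Lemma kinc_inj X J k (R : (X + J -> U) -> Prop) bs sigma :
  injective sigma -> kinc k R bs -> kinc k R (bs \o sigma).
Proof.
move=> sI K s us sk [x Hx]; apply: (K (map sigma s)); rewrite ?map_inj_uniq ?size_map //.
by exists x => _ /mapP[t ts ->]; exact: Hx.
Qed.

(* Along an ultrafilter, a dividing sequence over [B] converges to a complete type over [B `|` C]. *)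
Lemma dvd_over B C (X J : countType) (R : (X + J -> U) -> Prop) b k :
  ctbl B -> ctbl C -> DB B R -> dvd B R b k -> exists b', eqs B b b' /\ dvd (B `|` C) R b' k.
Proof.
move=> cB cC DR [bs [Hb Kb]].
have [W [WS WI W0 WU WN]] := nonprincipal_ultrafilter_exists.
pose G (Q : (nat * J -> U) -> Prop) :=
  (exists t S, [/\ DB (B `|` C) S, W [set i | S (bs i)] & Q = (fun z => S (row z t))]) \/
  (exists s : seq nat, [/\ uniq s, size s = k &
    Q = (fun z => ~ exists x, forall t, t \in s -> R (jn x (row z t)))]).
have Drow t S : DB (B `|` C) S -> DB (B `|` C) (fun z : nat * J -> U => S (row z t)).
  exact: (@DB_reind _ _ _ _ _ (fun j => (t, j))).
have [] := cU (B := B `|` C) (G := G); first exact: ctblU.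
- move=> Q [[t [S [DS _ ->]]]|[s [_ _ ->]]]; first exact: Drow.
  by apply: DB_kinc; apply: DB_mono DR; exact: subsetUl.
- move=> l lG.
  have [S [WSb HS]] : exists S : set (J -> U), W [set i | S (bs i)] /\
      forall z : nat * J -> U, (forall t, S (row z t)) -> kinc k R (row z) -> forall Q, In Q l -> Q z.
    elim: l lG => [|Q l IH] lG; first by exists setT; split=> //; apply: WS (WN 0) _.
    have [|S [WSb HS]] := IH; first by move=> P Pl; apply: lG; right.
    have [[i [S1 [DS1 WS1 QE]]]|[s [us sk QE]]] := lG Q (or_introl erefl).
      exists (S `&` S1); split=> [|z Hz Kz P [<-|Pl]]; first exact: WI.
      - by rewrite QE; have [] := Hz i.
      - by apply: HS => // t; have [] := Hz t.
    exists S; split=> // z Hz Kz P [<-|Pl]; last exact: HS.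
    by rewrite QE; apply: Kz.
  (* Sets in [W] are unbounded, so a strictly increasing subsequence of [bs] lies in [S];
     injectivity of its indices keeps it [k]-inconsistent. *)
  have next N : exists i, N <= i /\ S (bs i).
    apply: contrapT => H; apply: W0; apply: WS (WI _ _ WSb (WN N)) _ => i [Hi Ni].
    by apply: H; exists i.
  have [f Hf] := choice next.
  pose fix sigma n := if n is n'.+1 then f (sigma n').+1 else f 0.
  have sS n : sigma n < sigma n.+1 by have [] := Hf (sigma n).+1.
  have sI : injective sigma.
    exact: increasing_inj.
  exists (unrow (bs \o sigma)); apply: HS => [t|]; last exact: (kinc_inj sI Kb).
  by case: t => [|t]; [have [] := Hf 0|have [] := Hf (sigma t).+1].
move=> z Hz; exists (row z 0).
have E t S : DB (B `|` C) S -> W [set i | S (bs i)] -> S (row z t).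
  by move=> DS WSb; apply: (Hz (fun z => S (row z t))); left; exists t, S.
have Bl : B `<=` B `|` C by exact: subsetUl.
split=> [S DS Sb|].
  apply: E; first exact: DB_mono DS.
  by apply: WS (WN 0) _ => i _; exact: Hb.
exists (row z); split=> [t S DS S0|s us sk].
  apply: (E t S) => //; have [//|Wn] := WU [set i | S (bs i)].
  by have := E 0 _ (DB_not DS) Wn.
by apply: (Hz (fun z => ~ exists x, forall t, t \in s -> R (jn x (row z t)))); right; exists s.
Qed.

Lemma dvd_transfer B (X J K : countType) (R : (X + J -> U) -> Prop) b b1 (h h1 : K -> U) k :
  ctbl B -> DB B R -> eqs B (jn h b) (jn h1 b1) ->
  dvd (B `|` range h) R b k -> dvd (B `|` range h1) R b1 k.
Proof.
move=> cB DR E [bs [Hb Kb]].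
have [w Hw] := homogeneousl cU (unrow bs) cB E.
exists (row w); split=> [t|s us sk].
  apply/eqs_ext => S DS Sb.
  pose r1 (z : J + K) : (K + J) + nat * J :=
    match z with inl j => inl (inr j) | inr c => inl (inl c) end.
  pose r2 (z : J + K) : (K + J) + nat * J :=
    match z with inl j => inr (t, j) | inr c => inl (inl c) end.
  have E1 (x : K -> U) (y : J -> U) v : jn (jn x y) v \o r1 = jn y x by apply/funext => -[].
  have E2 (x : K -> U) (y : J -> U) v : jn (jn x y) v \o r2 = jn (row v t) x by apply/funext => -[].
  have := Hw _ (DB_imp (DB_reind r1 DS) (DB_reind r2 DS)).
  rewrite !E1 !E2; apply=> // Sb0.
  by have := Hb t; move/eqs_ext; apply.
apply: (Hw (fun z => ~ exists x, forall t, t \in s -> R (jn x (row (z \o inr) t)))).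
  exact: (DB_reind inr (DB_kinc s DR)).
exact: Kb.
Qed.

Section Chain.
Variables (I J : countType).
Implicit Types (l : list (((I + J -> U) -> Prop) * nat)) (x : I -> U) (g : J -> U).

(** The lengths of these chains measure the local dividing rank relative to [l], a finite set of
    formulas with their inconsistency constants. The head of the list is the link that divides over
    the smallest base. *)
Fixpoint chain l B x (gs : list (J -> U)) : Prop :=
  match gs with
  | nil => True
  | cons g gs' => (exists2 p, In p l & p.1 (jn x g) /\ dvd B p.1 g p.2) /\
      chain l (B `|` range g) x gs'
  end.

Lemma chain_anti l B C x gs : C `<=` B -> chain l B x gs -> chain l C x gs.
Proof.
elim: gs B C => //= g gs IH B C CB [[p pl [Hp Dp]] H]; split.
  by exists p => //; split=> //; apply: dvd_anti Dp.
by apply: IH H; apply: setSU.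
Qed.

(** Deleting links shrinks the bases of later ones, which preserves dividing. So the links that use
    [p] form a chain by themselves, and so do the others. *)
Lemma chain_pigeonhole p l B x gs n m : chain (p :: l)%list B x gs -> n + m <= size gs ->
  (exists gs', size gs' = n /\ chain (p :: nil)%list B x gs') \/
  (exists gs', size gs' = m /\ chain l B x gs').
Proof.
elim: gs B n m => [|g gs IH] B n m /=.
  by rewrite leqn0 addn_eq0 => _ /andP[/eqP -> _]; left; exists nil.
case=> -[q [<-|ql] [Hq Dq]] H.
  case: n => [|n] nm; first by left; exists nil.
  have [[gs' [s1 H1]]|[gs' [s1 H1]]] := IH _ n m H nm.
    left; exists (g :: gs')%list; rewrite /= s1; split=> //; split=> //.
    by exists p => //; left.
  right; exists gs'; split=> //; apply: chain_anti H1; exact: subsetUl.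
case: m => [|m] nm; first by right; exists nil.
have [|[gs' [s1 H1]]|[gs' [s1 H1]]] := IH _ n m H; first by rewrite addnS in nm.
  left; exists gs'; split=> //; apply: chain_anti H1; exact: subsetUl.
right; exists (g :: gs')%list; rewrite /= s1; split=> //; split=> //.
by exists q.
Qed.

Lemma chain_nth p B x gs d : chain (p :: nil)%list B x gs -> forall i, i < size gs ->
  p.1 (jn x (nth d gs i)) /\ dvd (B `|` upto (nth d gs) i) p.1 (nth d gs i) p.2.
Proof.
elim: gs B => //= g gs IH B [[_ [<-|//] [Hq Dq]] H] [|i] si /=.
  by split=> //; apply: dvd_anti Dq => u [//|[]].
have [H1 H2] := IH _ H i si; split=> //; apply: dvd_anti H2 => u [Bu|[[|j] ji]].
- by left; left.
- by left; right.
- by right; exists j.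
Qed.

(** In place of an automorphism, links are moved one at a time, each joining the tuple [h] whose
    conjugacy is maintained. *)
Lemma chain_transfer l B (K : countType) (h h1 : K -> U) x x1 gs : ctbl B ->
  (forall p, In p l -> DB B p.1) -> eqs B (jn h x) (jn h1 x1) -> chain l (B `|` range h) x gs ->
  exists gs1, size gs1 = size gs /\ chain l (B `|` range h1) x1 gs1.
Proof.
move=> cB lB; elim: gs K h h1 => [|g gs IH] K h h1 E /=; first by exists nil.
case=> -[p pl [Hp Dp]] H.
have [g1 Eg] := homogeneousl cU g cB E.
pose r (z : (K + J) + I) : (K + I) + J :=
  match z with inl (inl k) => inl (inl k) | inl (inr j) => inr j | inr i => inl (inr i) end.
have Er (a : K -> U) (y : I -> U) (c : J -> U) : jn (jn a y) c \o r = jn (jn a c) y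
  by apply/funext => -[[]|].
have E' : eqs B (jn (jn h g) x) (jn (jn h1 g1) x1) by have := eqs_reind r Eg; rewrite !Er.
have [|gs1 [s1 H1]] := IH _ _ _ E'; first by rewrite range_jn setUA.
exists (g1 :: gs1)%list; rewrite /= s1; split=> //; split; last by move: H1; rewrite range_jn setUA.
exists p => //; split.
  pose r' (z : I + J) : (K + I) + J := match z with inl i => inl (inr i) | inr j => inr j end.
  have Er' (a : K -> U) (y : I -> U) (c : J -> U) : jn (jn a y) c \o r' = jn y c
    by apply/funext => -[].
  by have := eqs_reind r' Eg _ (lB p pl); rewrite !Er'; apply.
by apply: dvd_transfer Dp => //; [exact: lB|exact: eqs_jnl E'].
Qed.

(** [dvd_over] conjugates the first link so that it divides over [C] as well; [x] and the tail
    follow by homogeneity and are treated over the enlarged base. The induction is on the length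
    because the tail is replaced by a conjugate. *)
Lemma chain_move l B C x gs : ctbl B -> ctbl C -> (forall p, In p l -> DB B p.1) ->
  chain l B x gs -> exists x' gs', [/\ size gs' = size gs, eqs B x x' & chain l (B `|` C) x' gs'].
Proof.
move=> cB cC; elim: {gs}(size gs) {-2}gs (erefl (size gs)) B cB x => [|n IH] [|g gs] //= sn B cB x lB.
  by move=> _; exists x, nil; split.
case=> -[p pl [Hp Dp]] H.
have [g1 [Eg D1]] := dvd_over cB cC (lB p pl) Dp.
have [x1 E1] := homogeneousl cU x cB Eg.
have [gs1 [s1 H1]] := chain_transfer cB lB E1 H.
have cB1 : ctbl (B `|` range g1) by apply: ctblU cB (ctbl_range g1).
have lB1 q : In q l -> DB (B `|` range g1) q.1.
  by move=> ql; apply: DB_mono (lB q ql); exact: subsetUl.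
have [x2 [gs2 [s2 E2 H2]]] := IH gs1 (etrans s1 (eq_add_S _ _ sn)) _ cB1 x1 lB1 H1.
exists x2, (g1 :: gs2)%list; split; first by rewrite /= s2 s1.
  apply: eqs_trans (eqs_jnr E1) _; apply: eqs_mono E2; exact: subsetUl.
split; last by move: H2; rewrite setUAC.
exists p => //; split=> //.
have := E2 _ (DB_spec (@subsetUr _ _ _) (lB1 p pl)); apply.
have := E1 _ (DB_reind (@swap I J) (lB p pl)); rewrite !jn_swap; exact.
Qed.

End Chain.
End Chains.

(** * Symmetry and transitivity *)

Section Calculus.
Variables (L : language) (U : struc L).
Hypotheses (cU : compact U) (lcU : local_character U).
Implicit Types (B C D : set U).

(** Compactness turns long finite chains into an infinite one for a single tuple, against
    [no_dividing_chain]. With [R] and [k] fixed, dividing of each link is a set of first-order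
    conditions on the link and a witnessing sequence. *)
Lemma no_long_chains1 B (I : finType) (J : countType) (R : (I + J -> U) -> Prop) k :
  ctbl B -> DB B R ->
  ~ forall n, exists x gs, size gs = n /\ chain ((R, k) :: nil)%list B x gs.
Proof.
move=> cB DR H.
(* The coordinates are the tuple, the links, and for each link a sequence witnessing that it
   divides. *)
pose A := (I + (nat * J + nat * (nat * J)))%type.
pose px (z : A -> U) : I -> U := z \o inl.
pose pg (z : A -> U) i : J -> U := row (z \o inr \o inl) i.
pose pw (z : A -> U) i : nat * J -> U := row (z \o inr \o inr) i.
pose pre (g : nat -> J -> U) i : 'I_i * J -> U := fun q => g q.1 q.2.
(* The second family expresses by implications that each witness has the type of link [i] over [B]
   and the earlier links, without fixing that type in advance. *)
pose Gn i (Q : (A -> U) -> Prop) := [\/ Q = (fun z => R (jn (px z) (pg z i))),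
  exists t S, DB B S /\ Q = (fun z => S (jn (pg z i) (pre (pg z) i)) ->
     S (jn (row (pw z i) t) (pre (pg z) i))) |
  exists s : seq nat, [/\ uniq s, size s = k &
     Q = (fun z => ~ exists x, forall t, t \in s -> R (jn x (row (pw z i) t)))]].
have [] := cU (B := B) (G := fun Q => exists i, Gn i Q) cB.
- move=> Q [i [->|[t [S [DS ->]]]|[s [us sk ->]]]].
  + pose r (z : I + J) : A := match z with inl i => inl i | inr j => inr (inl (i, j)) end.
    apply: DB_ext (DB_reind r DR) => z.
    suff -> : z \o r = jn (px z) (pg z i) by [].
    by apply/funext => -[].
  + pose r1 (z : J + 'I_i * J) : A :=
      match z with inl j => inr (inl (i, j)) | inr q => inr (inl (nat_of_ord q.1, q.2)) end.
    pose r2 (z : J + 'I_i * J) : A :=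
      match z with inl j => inr (inr (i, (t, j))) | inr q => inr (inl (nat_of_ord q.1, q.2)) end.
    apply: DB_ext (DB_imp (DB_reind r1 DS) (DB_reind r2 DS)) => z.
    have -> : z \o r1 = jn (pg z i) (pre (pg z) i) by apply/funext => -[].
    by have -> : z \o r2 = jn (row (pw z i) t) (pre (pg z) i) by apply/funext => -[].
  + exact: (DB_reind (fun q : nat * J => inr (inr (i, q)) : A) (DB_kinc s DR)).
- move=> l lG.
  have [n Hn] : exists n, forall Q, In Q l -> exists2 i, i < n & Gn i Q.
    elim: l lG => [|Q l IH] lG; first by exists 0.
    have [|n Hn] := IH; first by move=> P Pl; apply: lG; right.
    have [i Gi] := lG Q (or_introl erefl).
    exists (maxn i.+1 n) => P [<-|/Hn [j jn Gj]].
      by exists i => //; rewrite leq_max leqnn.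
    by exists j => //; rewrite leq_max jn orbT.
  have [x [gs [sn ch]]] := H n.
  pose d : J -> U := fun _ => witness U.
  have Hg i : i < n -> R (jn x (nth d gs i)) /\ dvd (B `|` upto (nth d gs) i) R (nth d gs i) k.
    by rewrite -sn; exact: (chain_nth d ch).
  have Hw i : exists w : nat * J -> U, i < n ->
      (forall t, eqs (B `|` upto (nth d gs) i) (nth d gs i) (row w t)) /\ kinc k R (row w).
    have [/Hg [_ [bs Hbs]]|] := ltnP i n; first by exists (unrow bs).
    by exists (fun _ => witness U).
  have [w {}Hw] := choice Hw.
  exists (jn x (jn (unrow (nth d gs)) (unrow w))) => Q /Hn [i iN].
  have [Hi1 Hi2] := Hw i iN.
  have Eg : pg (jn x (jn (unrow (nth d gs)) (unrow w))) = nth d gs by [].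
  have Ew : pw (jn x (jn (unrow (nth d gs)) (unrow w))) i = w i by apply/funext => -[].
  case=> [->|[t [S [DS ->]]]|[s [us sk ->]]].
  + by have [] := Hg i iN.
  + rewrite Ew Eg => HS.
    suff : eqs (B `|` range (pre (nth d gs) i)) (nth d gs i) (row (w i) t).
      by move/eqs_ext; apply.
    apply: eqs_mono (Hi1 t); apply: setUS => u [[j c] _ <-].
    by exists j => //; exists c.
  + by rewrite Ew; apply: Hi2.
move=> z Hz.
apply: (@no_dividing_chain L U cU lcU I J B (px z) (pg z) cB) => i.
exists R, k; split.
- by apply: DB_mono DR; exact: subsetUl.
- by apply: (Hz (fun z => R (jn (px z) (pg z i)))); exists i; constructor 1.
exists (row (pw z i)); split=> [t|s us sk].
  apply: (@eqs_mono _ _ _ (B `|` range (pre (pg z) i))).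
    by apply: setUS => u [j ji [c _ <-]]; exists (Ordinal ji, c).
  apply/eqs_ext => S DS.
  apply: (Hz (fun z => S (jn (pg z i) (pre (pg z) i)) -> S (jn (row (pw z i) t) (pre (pg z) i)))).
  by exists i; constructor 2; exists t, S.
apply: (Hz (fun z => ~ exists x, forall t, t \in s -> R (jn x (row (pw z i) t)))).
by exists i; constructor 3; exists s.
Qed.

Lemma no_long_chains B (I : finType) (J : countType) (l : list (((I + J -> U) -> Prop) * nat)) :
  ctbl B -> (forall p, In p l -> DB B p.1) ->
  ~ forall n, exists x gs, size gs = n /\ chain l B x gs.
Proof.
move=> cB; elim: l => [|p l IH] lB H.
  by have [x [[|g gs] [//= _ [[]]]]] := H 1.
have [] := lem (forall n, exists x gs, size gs = n /\ chain (p :: nil)%list B x gs).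
  by case: p lB H => R k lB _; apply: no_long_chains1 => //; apply: (lB (R, k)); left.
move=> /existsNP [n Hn].
apply: IH => [q ql|m]; first by apply: lB; right.
have [x [gs [sg ch]]] := H (n + m).
have [||[gs' Hgs']] := @chain_pigeonhole _ _ _ _ p l B x gs n m ch; first by rewrite sg.
  by move=> [gs' Hgs']; case: Hn; exists x, gs'.
by exists x, gs'.
Qed.

(* Otherwise every dividing chain realized in [S] could be moved so as to divide over [b] as well, and then prolonged by [b]. *)
Lemma no_dividing_cover B (I : finType) (J : countType) (b : J -> U)
    (l : list (((I + J -> U) -> Prop) * nat)) (S : (I -> U) -> Prop) :
  ctbl B -> DB B S -> (forall p, In p l -> DB B p.1 /\ dvd B p.1 b p.2) -> (exists x, S x) ->
  exists x, S x /\ forall p, In p l -> ~ p.1 (jn x b).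
Proof.
move=> cB DS lB [x0 Sx0]; apply: contrapT => N.
have cov x : S x -> exists2 p, In p l & p.1 (jn x b).
  move=> Sx; apply: contrapT => N'; apply: N; exists x; split=> // p pl Hp.
  by apply: N'; exists p.
have lB1 p : In p l -> DB B p.1 by move=> /lB [].
apply: (@no_long_chains B I J l cB lB1) => n.
suff [x [gs [_ H1 H2]]] : exists x gs, [/\ S x, size gs = n & chain l B x gs] by exists x, gs.
elim: n => [|n [x [gs [Sx sg ch]]]]; first by exists x0, nil.
have [x' [gs' [s' E ch']]] := chain_move cU cB (ctbl_range b) lB1 ch.
have Sx' : S x' by exact: E Sx.
exists x', (b :: gs')%list; split=> //=; first by rewrite s' sg.
split=> //; have [p pl Hp] := cov x' Sx'.
by exists p => //; split=> //; have [] := lB p pl.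
Qed.

(** Two base sets appear because [nd_extend] preserves the type over [B] and [b] while avoiding
    formulas that divide over [B] only. *)
Lemma nd_realize B D (I : finType) (J : countType) (a : I -> U) (b : J -> U) :
  ctbl B -> ctbl D -> B `<=` D ->
  (forall (S : (I -> U) -> Prop) (l : list (((I + J -> U) -> Prop) * nat)), DB D S -> S a ->
     (forall p, In p l -> DB B p.1 /\ dvd B p.1 b p.2) ->
     exists x, S x /\ forall p, In p l -> ~ p.1 (jn x b)) ->
  exists a', eqs D a a' /\ nd B a' b.
Proof.
move=> cB cD BD H.
pose G (Q : (I -> U) -> Prop) := (DB D Q /\ Q a) \/
  (exists R k, [/\ DB B R, dvd B R b k & Q = (fun x => ~ R (jn x b))]).
have [] := cU (B := D `|` range b) (G := G).
- exact: ctblU cD (ctbl_range b).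
- move=> Q [[DQ _]|[R [k [DR _ ->]]]]; first by apply: DB_mono DQ; exact: subsetUl.
  apply: DB_not; apply: DB_spec; first exact: subsetUr.
  by apply: DB_mono DR; apply: subset_trans BD _; exact: subsetUl.
- move=> l lG.
  have [S [l' [DS Sa Hl' HS]]] : exists S (l' : list (((I + J -> U) -> Prop) * nat)),
      [/\ DB D S, S a, forall p, In p l' -> DB B p.1 /\ dvd B p.1 b p.2 &
      forall x, S x -> (forall p, In p l' -> ~ p.1 (jn x b)) -> forall Q, In Q l -> Q x].
    elim: l lG => [|Q l IH] lG.
      by exists (fun _ => True), nil; split=> //; exact: DB_const.
    have [|S [l' [DS Sa Hl' HS]]] := IH; first by move=> P Pl; apply: lG; right.
    have [[DQ Qa]|[R [k [DR Dv QE]]]] := lG Q (or_introl erefl).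
      exists (fun x => S x /\ Q x), l'; split=> //; first exact: DB_and.
      by move=> x [Sx Qx] K P [<-|]//; exact: HS.
    exists S, ((R, k) :: l')%list; split=> // [p [<-//|/Hl'//]|x Sx K P [<-|]].
      by rewrite QE; apply: (K (R, k)); left.
    by apply: HS => // p pl; apply: K; right.
  have [x [Sx Hx]] := H S l' DS Sa Hl'.
  by exists x; exact: HS.
move=> a' Ha'; exists a'; split=> [Q DQ Qa|R DR Rab k Dv]; first by apply: Ha'; left.
by apply: (Ha' (fun x => ~ R (jn x b))) => //; right; exists R, k.
Qed.

Lemma nd_exists B (I : finType) (J : countType) (a : I -> U) (b : J -> U) :
  ctbl B -> exists a', eqs B a a' /\ nd B a' b.
Proof.
move=> cB; apply: nd_realize => // S l DS Sa lB.
by apply: (no_dividing_cover cB DS lB); exists a.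
Qed.

Lemma nd_exists_r B (I : finType) (J : countType) (a : I -> U) (b : J -> U) :
  ctbl B -> exists b', eqs B b b' /\ nd B a b'.
Proof.
move=> cB; have [a' [E nd']] := nd_exists a b cB.
have [b' E'] := homogeneousl cU b cB (eqs_sym E).
by exists b'; split; [exact: eqs_jnr E'|exact: nd_conj nd'].
Qed.

(** Indiscernibility is not requested: [Ind] makes a formula dividing at [g n] divide over the
    earlier terms too, which is what a chain needs. *)
Lemma morley_sequence B (J : finType) (d : J -> U) : ctbl B ->
  exists g : nat -> J -> U, forall n, eqs B d (g n) /\ Ind B (upto g n) (g n).
Proof.
move=> cB.
pose P (s : seq (J -> U)) d' := eqs B d d' /\ Ind B (upto (nth d s) (size s)) d'.
have [s|g Hg] := @seq_build _ P.
  pose h (q : 'I_(size s) * J) := nth d s q.1 q.2.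
  have [d' [E nd']] := nd_exists_r h d cB.
  exists d'; split=> //; apply: Ind_sub (nd_Ind cU cB nd') => u [j js [c _ <-]].
  by exists (Ordinal js, c).
exists g => n; have [E In'] := Hg n; split=> //; apply: Ind_sub In' => u [j jn Hu].
by exists j; rewrite ?size_mkseq // nth_mkseq.
Qed.

(** If it failed, some [S'] true of [a] and [b] would be covered by finitely many formulas dividing
    at the pair of [b] and [e]. Along an independent sequence of conjugates of this pair,
    arbitrarily many instances of [S'] share a solution since [S'] does not divide, and the covering
    formulas satisfied by it form a long chain. *)
Lemma nd_extend B (I J E : finType) (a : I -> U) (b : J -> U) (e : E -> U) :
  ctbl B -> nd B a b -> exists a', eqs (B `|` range b) a a' /\ nd B a' (jn b e).
Proof.
move=> cB nab.
apply: (nd_realize cB (ctblU cB (ctbl_range b)) (@subsetUl _ _ _)).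
move=> S l /DB_abs [S' [DS' SE]] /SE Sa lB; apply: contrapT => N.
pose V (z : J + E -> U) := forall x, S' (jn x (z \o inl)) -> exists2 p, In p l & p.1 (jn x z).
have DV : DB B V.
  apply: (@DB_all _ _ B _ I (fun z => S' (jn (z \o inl) (z \o inr \o inl)) ->
    exists2 p, In p l & p.1 (jn (z \o inl) (z \o inr)))).
  apply: DB_imp.
    pose r (z : I + J) : I + (J + E) := match z with inl i => inl i | inr j => inr (inl j) end.
    apply: DB_ext (DB_reind r DS') => z.
    suff -> : z \o r = jn (z \o inl) (z \o inr \o inl) by [].
    by apply/funext => -[].
  apply: DB_exists_in => p pl; apply: DB_ext (proj1 (lB p pl)) => z.
  by rewrite jn_eta.
have Vd : V (jn b e).
  move=> x Sx; apply: contrapT => N'; apply: N; exists x; split; first exact/SE.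
  by move=> p pl Hp; apply: N'; exists p.
have [g Hg] := morley_sequence (jn b e) cB.
apply: (@no_long_chains B I (J + E)%type l cB) => [p /lB[]//|n].
have [s [x [us sn Hx]]] : exists (s : seq nat) x,
    [/\ uniq s, size s = n & forall t, t \in s -> S' (jn x (g t \o inl))].
  apply: contrapT => N'; apply: (nab S' DS' Sa n).
  exists (fun t => g t \o inl); split=> [t|s us sn [x Hx]].
    by have [Et _] := Hg t; have := eqs_reind inl Et.
  by apply: N'; exists s, x.
(* A term is known to be independent only of terms with smaller index, so the links are taken in
   increasing order. *)
exists x, [seq g t | t <- sort leq s]; split; first by rewrite size_map size_sort.
have Hs t : t \in sort leq s -> exists2 p, In p l & p.1 (jn x (g t)).
  by rewrite mem_sort => /Hx Sx; have [Et _] := Hg t; exact: (Et V DV Vd).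
have : sorted ltn (sort leq s).
  by rewrite ltn_sorted_uniq_leq sort_uniq us sort_sorted //; exact: leq_total.
suff K s' C m : (forall t, t \in s' -> exists2 p, In p l & p.1 (jn x (g t))) ->
    C `<=` B `|` upto g m -> (forall t, t \in s' -> m <= t) -> sorted ltn s' ->
    chain l C x [seq g t | t <- s'].
  by apply: (K _ _ 0); [exact: Hs|exact: subsetUl|].
elim: s' C m {Hs} => //= t s' IH C m Hs CB mt st; split.
  have [p pl Hp] := Hs t (mem_head _ _); exists p => //; split=> //.
  have [Et It] := Hg t; have [Dp dp] := lB p pl.
  apply: (@dvd_anti _ _ (B `|` upto g t)); last by apply: It => //; apply: dvd_conj dp.
  apply: (subset_trans CB); apply: setUS; apply: upto_mono; apply: mt; exact: mem_head.
apply: (IH _ t.+1).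
- by move=> t' t's; apply: Hs; rewrite in_cons t's orbT.
- move=> u [/CB [Bu|Hu]|Hu]; [by left|right|right; by exists t].
  by apply: upto_mono Hu; apply: leqW; apply: mt; exact: mem_head.
- move=> t' t's; move: st; rewrite path_sortedE; last exact: ltn_trans.
  by move=> /andP[/allP/(_ _ t's)].
- exact: path_sorted st.
Qed.

Fixpoint independent_list B C (J : Type) (gs : list (J -> U)) : Prop :=
  match gs with
  | nil => True
  | cons g gs' => Ind B C g /\ independent_list B (C `|` range g) gs'
  end.

(** The new element goes in front. Appending it would require [nd B e g], which is the symmetry
    still to be proved; with [nd B g e] each later [h] stays independent of its predecessors after
    [g] joins them, by [nd_base] and [Ind_trans]. *)
Lemma independent_list_prepend B (I J K E : finType) (g : I -> U) (gs : list (J -> U))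
    (c : K -> U) (e : E -> U) :
  ctbl B -> nd B g e -> range c `<=` range e -> (forall h, In h gs -> range h `<=` range e) ->
  independent_list B (range c) gs -> independent_list B (range c `|` range g) gs.
Proof.
move=> cB nge; elim: gs K c => //= h gs IH K c ce gse [Ih H]; split.
  apply: Ind_trans Ih _; apply: nd_Ind => //; first exact: ctblU cB (ctbl_range c).
  apply: nd_base; apply: nd_sub nge => //; rewrite range_jn => u [Hu|/ce//].
  by apply: (gse h) Hu; left.
rewrite setUAC -range_jn; apply: IH.
- by rewrite range_jn => u [/ce//|Hu]; apply: (gse h) Hu; left.
- by move=> h' h'g; apply: gse; right.
- by rewrite range_jn.
Qed.

(** Extension gives arbitrarily long independent lists of realizations of the type of [a] over [B]
    and [b]. If [R] held of [b] and [a] and divided at [a], each such list would be a chain for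
    [b]. *)
Theorem nd_sym B (I J : finType) (a : I -> U) (b : J -> U) : ctbl B -> nd B a b -> nd B b a.
Proof.
move=> cB nab R DR Rba k Dv.
apply: (@no_long_chains1 B J I R k cB DR) => n.
have [gs [sg ag ig]] : exists gs : seq (I -> U), [/\ size gs = n,
    forall g, In g gs -> eqs (B `|` range b) a g & independent_list B set0 gs].
  elim: n => [|n [gs [sg ag ig]]]; first by exists nil.
  pose e (q : 'I_(size gs) * I) := nth a gs q.1 q.2.
  have [g [ag' ng]] := nd_extend e cB nab.
  exists (g :: gs)%list; split=> [|h [<-//|/ag//]|] /=; first by rewrite sg.
  split; first by move=> X R' k' _; rewrite setU0.
  have R0 : range (fun i : 'I_0 => witness U) = set0.
    by apply/seteqP; split=> // u [[]].
  rewrite -R0; apply: (independent_list_prepend (e := e)) => //.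
  - by apply: nd_sub ng => //; rewrite range_jn; exact: subsetUr.
  - by rewrite R0.
  - move=> h hgs u [i _ <-].
    have [j jgs <-] : exists2 j, j < size gs & nth a gs j = h.
      elim: (gs) hgs => //= h' gs' IH [->|/IH[j js Hj]]; first by exists 0.
      by exists j.+1.
    by exists (Ordinal jgs, i).
  - by rewrite R0.
exists b, gs; split=> //; rewrite -[X in chain _ X]setU0; move: ag ig {sg}.
elim: gs (set0) => //= g gs IH C ag [Ig ig]; split.
  exists (R, k); first by left.
  split=> /=; last by apply: Ig => //; apply: dvd_conj Dv; apply: eqs_mono (ag g (or_introl erefl)); exact: subsetUl.
  have := ag g (or_introl erefl); move/eqs_ext/eqs_swap; exact.
by rewrite -setUA; apply: IH => // h hg; apply: ag; right.
Qed.

Lemma nd_jnl B (I J K : finType) (a : I -> U) (b : J -> U) (c : K -> U) :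
  ctbl B -> nd B b a -> nd (B `|` range b) c a -> nd B (jn b c) a.
Proof.
move=> cB nb nc; apply: Ind_nd; rewrite range_jn; apply: Ind_trans; first exact: nd_Ind.
by apply: nd_Ind => //; apply: ctblU cB (ctbl_range b).
Qed.

Lemma nd_jnr B (I J K : finType) (a : I -> U) (b : J -> U) (c : K -> U) :
  ctbl B -> nd B a b -> nd (B `|` range b) a c -> nd B a (jn b c).
Proof.
move=> cB nb nc; have cBb := ctblU cB (ctbl_range b).
by apply: nd_sym => //; apply: nd_jnl => //; apply: nd_sym.
Qed.

Lemma nd_basel B (I J K : finType) (a : I -> U) (b : J -> U) (c : K -> U) :
  ctbl B -> nd B (jn a c) b -> nd (B `|` range c) a b.
Proof.
move=> cB H; apply: nd_sym; first exact: ctblU cB (ctbl_range c).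
by apply: nd_base; apply: nd_sym.
Qed.

End Calculus.

(** * Semi-isolation *)

Section SemiIsolation.
Variables (L : language) (U : struc L).
Hypotheses (cU : compact U) (lcU : local_character U).
Variables (P : finType) (b : P -> U).

(** Only the type of [e] matters: the formula over [b] must be satisfied by some realization of it,
    not by [e] itself. *)
Definition powerful : Prop :=
  forall (M : finType) (e : M -> U), exists chi : (P + M -> U) -> Prop,
    [/\ DB set0 chi, exists z, chi (jn b z) & forall z, chi (jn b z) -> eqs set0 e z].

Definition nonisolated : Prop :=
  forall theta : (P -> U) -> Prop, DB set0 theta -> theta b ->
    exists c, theta c /\ ~ eqs set0 b c.

Definition semi_isolates (c e : P -> U) : Prop :=
  exists phi : (P + P -> U) -> Prop, [/\ DB set0 phi, phi (jn c e) &
    forall c' e', eqs set0 b c' -> phi (jn c' e') -> eqs set0 b e'].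

Lemma semi_isolates_conj c c' e e' :
  eqs set0 (jn c e) (jn c' e') -> semi_isolates c e -> semi_isolates c' e'.
Proof. by move=> E [phi [D Hce H]]; exists phi; split=> //; apply: E. Qed.

Lemma semi_isolates_refl c : semi_isolates c c.
Proof.
exists (fun z => forall i, i \in enum P -> z (inl i) = z (inr i)); split=> //.
  by apply: DB_all_in => i _; exact: DB_eq.
move=> c' e' pc H; suff <- : c' = e' by [].
by apply/funext => i; apply: H; rewrite mem_enum.
Qed.

Lemma semi_isolates_trans c d e : semi_isolates c d -> semi_isolates d e -> semi_isolates c e.
Proof.
move=> [phi [D Hcd H]] [psi [D' Hde H']].
exists (fun z => exists y, phi (jn (z \o inl) y) /\ psi (jn y (z \o inr))); split.
- apply: (@DB_ex _ _ set0 _ P (fun z => phi (jn (z \o inr \o inl) (z \o inl)) /\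
    psi (jn (z \o inl) (z \o inr \o inr)))).
  pose r1 (z : P + P) : P + (P + P) := match z with inl i => inr (inl i) | inr i => inl i end.
  pose r2 (z : P + P) : P + (P + P) := match z with inl i => inl i | inr i => inr (inr i) end.
  apply: DB_ext (DB_and (DB_reind r1 D) (DB_reind r2 D')) => z.
  have -> : z \o r1 = jn (z \o inr \o inl) (z \o inl) by apply/funext => -[].
  by have -> : z \o r2 = jn (z \o inl) (z \o inr \o inr) by apply/funext => -[].
- by exists d.
- by move=> c' e' pc [y [Hy]]; apply: H'; apply: H Hy.
Qed.

(** Two steps by [lam] and [rho] from a realization of the type of [b] end in that type, hence in
    [theta]; by compactness a single formula of the type already forces this. *)
Lemma semi_isolates_approx (lam rho : (P + P -> U) -> Prop) (theta : (P -> U) -> Prop) :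
  DB set0 lam -> DB set0 rho -> DB set0 theta -> theta b ->
  (forall c' e', eqs set0 b c' -> lam (jn c' e') -> eqs set0 b e') ->
  (forall c' e', eqs set0 b c' -> rho (jn c' e') -> eqs set0 b e') ->
  exists theta', [/\ DB set0 theta', theta' b &
    forall x y z, theta' x -> lam (jn x y) -> rho (jn y z) -> theta z].
Proof.
move=> Dl Dr Dt tb Hl Hr; apply: contrapT => N.
pose r1 (z : P + P) : P + (P + P) := match z with inl i => inl i | inr i => inr (inl i) end.
pose r2 (z : P + P) : P + (P + P) := match z with inl i => inr (inl i) | inr i => inr (inr i) end.
pose V (z : P + (P + P) -> U) := [/\ lam (z \o r1), rho (z \o r2) & ~ theta (z \o inr \o inr)].
have DV : DB set0 V.
  have D3 := DB_not (DB_reind (fun i : P => inr (inr i) : P + (P + P)) Dt).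
  by apply: DB_ext (DB_and (DB_reind r1 Dl) (DB_and (DB_reind r2 Dr) D3)) => z; split=> [[? []]|[]].
pose G (Q : (P + (P + P) -> U) -> Prop) :=
  Q = V \/ exists S, [/\ DB set0 S, S b & Q = (fun z => S (z \o inl))].
have [] := cU (B := set0) (G := G); first exact: ctbl0.
- by move=> Q [->|[S [DS _ ->]]] //; exact: DB_reind.
- move=> l lG.
  have [S [DS Sb HS]] : exists S, [/\ DB set0 S, S b &
      forall z : P + (P + P) -> U, V z -> S (z \o inl) -> forall Q, In Q l -> Q z].
    elim: l lG => [|Q l IH] lG; first by exists (fun _ => True); split=> //; exact: DB_const.
    have [|S [DS Sb HS]] := IH; first by move=> R Rl; apply: lG; right.
    have [->|[S1 [DS1 S1b ->]]] := lG Q (or_introl erefl).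
      by exists S; split=> // z Vz Sz R [<-|]//; exact: HS.
    exists (fun x => S x /\ S1 x); split=> //; first exact: DB_and.
    by move=> z Vz [Sz S1z] R [<-|]//; exact: HS.
  apply: contrapT => N'; apply: N; exists S; split=> // x y z Sx lxy ryz.
  apply: contrapT => tz; apply: N'; exists (jn x (jn y z)); apply: HS => //; split=> //.
  + by have -> : jn x (jn y z) \o r1 = jn x y by apply/funext => -[].
  + by have -> : jn x (jn y z) \o r2 = jn y z by apply/funext => -[].
move=> z Hz; have [] : V z by apply: Hz; left.
have -> : z \o r1 = jn (z \o inl) (z \o inr \o inl) by apply/funext => -[].
have -> : z \o r2 = jn (z \o inr \o inl) (z \o inr \o inr) by apply/funext => -[].
move=> lz rz; apply; apply: (Hr _ _ _ rz) => //; apply: (Hl _ _ _ lz) => S DS Sb.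
by apply: (Hz (fun z => S (z \o inl))); right; exists S.
Qed.

(* Choose pairs [(l_t, f_t)] near the type of [(l, f)] with [f_t] outside the nonisolated type [p] of [b], and [l_t] so close to [p] that nothing between [l_t] and an earlier [f_s] exists: the formula "between [l] and [f]" 2-divides. *)
Lemma between_divides l y f : nonisolated -> eqs set0 b l ->
  semi_isolates l y -> semi_isolates y f -> ~ nd set0 y (jn l f).
Proof.
move=> niso pl [lam [Dl lly Hl]] [rho [Dr ryf Hr]] nyl.
pose iota (z : P + (P + P) -> U) :=
  lam (jn (z \o inr \o inl) (z \o inl)) /\ rho (jn (z \o inl) (z \o inr \o inr)).
have Di : DB set0 iota.
  pose r1 (z : P + P) : P + (P + P) := match z with inl i => inr (inl i) | inr i => inl i end.
  pose r2 (z : P + P) : P + (P + P) := match z with inl i => inl i | inr i => inr (inr i) end.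
  apply: DB_ext (DB_and (DB_reind r1 Dl) (DB_reind r2 Dr)) => z.
  have -> : z \o r1 = jn (z \o inr \o inl) (z \o inl) by apply/funext => -[].
  by have -> : z \o r2 = jn (z \o inl) (z \o inr \o inr) by apply/funext => -[].
apply: (nyl iota Di _ 2); first by split.
have pf : eqs set0 b f by apply: (Hr y) ryf; apply: (Hl l) lly.
have greedy (tau : (P + P -> U) -> Prop) : DB set0 tau -> tau (jn l f) ->
    exists g : nat -> P + P -> U, (forall t, tau (g t)) /\
      forall s t, s < t -> forall y', lam (jn (g t \o inl) y') -> ~ rho (jn y' (g s \o inr)).
  move=> Dtau tau_lf.
  (* [seq_build] asks for a successor of every history, so only those earlier pairs that end outside
     the type are constrained. *)
  pose Q (s : seq (P + P -> U)) x := [/\ tau x, ~ eqs set0 b (x \o inr) &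
    forall h, In h s -> ~ eqs set0 b (h \o inr) ->
      forall y', lam (jn (x \o inl) y') -> ~ rho (jn y' (h \o inr))].
  have [s|g Hg] := @seq_build _ Q; last first.
    exists g; split=> [t|s t st y' Hly]; first by have [] := Hg t.
    have [_ _ H] := Hg t; apply: (H (g s)) Hly; last by have [] := Hg s.
    move: st; elim: t {H} => // t IH; rewrite ltnS leq_eqVlt mkseqS => /orP[/eqP ->|/IH H].
      by elim: (mkseq g t) => [|h s' IHs] /=; [left|right].
    by elim: (mkseq g t) H => //= h s' IHs [->|/IHs]; [left|right].
  have [th [Dth thb Hth]] : exists th, [/\ DB set0 th, th b & forall h, In h s ->
      ~ eqs set0 b (h \o inr) -> forall x y', th x -> lam (jn x y') -> ~ rho (jn y' (h \o inr))].
    elim: s => [|h s [th [Dth thb Hth]]]; first by exists (fun _ => True); split=> //; exact: DB_const.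
    have [ph|nph] := lem (eqs set0 b (h \o inr)).
      by exists th; split=> // h' [<-|]//; exact: Hth.
    have /existsNP[S /not_implyP[DS /not_implyP[Sb nSh]]] := nph.
    have [th' [Dth' th'b Hth']] := semi_isolates_approx Dl Dr DS Sb Hl Hr.
    exists (fun x => th x /\ th' x); split=> //; first exact: DB_and.
    move=> h' [<-|h's] nph' x y' [thx th'x] lx; last exact: (Hth h' h's nph' x y' thx lx).
    by move=> ry; apply: nSh; exact: Hth' lx ry.
  (* This formula holds of [f], with [l] as witness, so it belongs to the type of [b]; nonisolation
     supplies a solution outside the type. *)
  have Dkappa : DB set0 (fun z => exists x, tau (jn x z) /\ th x).
    apply: (@DB_ex _ _ set0 P P (fun z => tau z /\ th (z \o inl))).
    by apply: DB_and => //; exact: DB_reind.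
  have kb : exists x, tau (jn x b) /\ th x.
    by apply: (eqs_sym pf Dkappa); exists l; split=> //; exact: pl.
  have [] := niso _ Dkappa kb.
  move=> z [[x [tx thx]] npz]; exists (jn x z); split=> // h hs nph y'.
  exact: (Hth h hs nph).
(* The greedy sequences satisfy only one formula [tau] of the type of the pair; compactness yields
   exact conjugates. *)
pose G (Q : (nat * (P + P) -> U) -> Prop) :=
  (exists t S, [/\ DB set0 S, S (jn l f) & Q = (fun z => S (row z t))]) \/
  (exists s : seq nat, [/\ uniq s, size s = 2 &
    Q = (fun z => ~ exists x, forall t, t \in s -> iota (jn x (row z t)))]).
have [] := cU (B := set0) (G := G); first exact: ctbl0.
- move=> Q [[t [S [DS _ ->]]]|[s [_ _ ->]]]; last exact: DB_kinc.
  exact: (DB_reind (fun j => (t, j)) DS).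
- move=> lq lG.
  have [S [DS Sb HS]] : exists S : (P + P -> U) -> Prop, [/\ DB set0 S, S (jn l f) &
      forall z : nat * (P + P) -> U, (forall t, S (row z t)) -> kinc 2 iota (row z) ->
        forall Q, In Q lq -> Q z].
    elim: lq lG => [|Q lq IH] lG; first by exists (fun _ => True); split=> //; exact: DB_const.
    have [|S [DS Sb HS]] := IH; first by move=> R Rl; apply: lG; right.
    have [[t [S1 [DS1 S1b ->]]]|[s [us sk ->]]] := lG Q (or_introl erefl).
      exists (fun x => S x /\ S1 x); split=> //; first exact: DB_and.
      move=> z Hz Kz R [<-|]; first by have [] := Hz t.
      by apply: HS => // t'; have [] := Hz t'.
    by exists S; split=> // z Hz Kz R [<-|]; [apply: Kz|exact: HS].
  have [g [Hg1 Hg2]] := greedy S DS Sb.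
  exists (unrow g); apply: HS => // -[|s [|t [|]]] //= /andP[]; rewrite inE => st _ _ [x Hx].
  have [ls rs] := Hx s (mem_head _ _).
  have [|lt rt] := Hx t; first by rewrite !inE eqxx orbT.
  have [lts|lts|E] := ltngtP s t; last by rewrite E eqxx in st.
    exact: (Hg2 s t lts x lt rs).
  exact: (Hg2 t s lts x ls rt).
move=> z Hz; exists (row z); split=> [t S DS Sb|s us sk].
  by apply: (Hz (fun z => S (row z t))); left; exists t, S.
by apply: (Hz (fun z => ~ exists x, forall t, t \in s -> iota (jn x (row z t)))); right; exists s.
Qed.

Lemma semi_isolates_dependent c e : nonisolated -> eqs set0 b c -> semi_isolates c e ->
  ~ nd set0 c e.
Proof.
move=> niso pc ce nce; have c0 := @ctbl0 L U.
have pe : eqs set0 b e by have [phi [_ Hce H]] := ce; apply: H Hce.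
have [l El] := homogeneous cU c c0 (eqs_trans (eqs_sym pe) pc).
have [l' [El' nl']] := nd_extend cU lcU e c0 (nd_conj El nce).
have E' : eqs set0 (jn c e) (jn l' c).
  by apply: eqs_trans El _; move/eqs_ext: El'.
apply: (@between_divides l' c e niso) => //.
- apply: eqs_trans pc _; exact: eqs_jnl E'.
- exact: semi_isolates_conj E' ce.
have nec : nd set0 e c by exact: nd_sym.
have nel : nd set0 (jn e l') c by apply: nd_jnl => //; apply: nd_base.
apply: (nd_sub cU c0 _ (nd_sym cU lcU c0 nel)).
by rewrite !range_jn setUC.
Qed.

(* An element semi-isolating an infinite independent sequence would depend on each of its terms. *)
Theorem powerful_isolated : powerful -> nonisolated -> False.
Proof.
move=> pow niso; have c0 := @ctbl0 L U.
have [e0 [pe0 ne0]] := nd_exists cU lcU b b c0.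
have [chi [Dchi [z0 chi0] Hchi]] := pow _ (jn b e0).
(* The left half of [z] is the next element of the sequence and the right half is the element set
   aside. In the facts below, [i] selects the left half when true. *)
pose link c z := eqs set0 (jn b z0) (jn c z).
have Ez0 := Hchi z0 chi0.
have pz0 i z : eqs set0 (jn b e0) z -> eqs set0 b (if i then z \o inl else z \o inr).
  move=> E; case: i; first exact: (eqs_reind inl E).
  apply: eqs_trans pe0 _; exact: (eqs_reind inr E).
have zlink c z i : link c z -> eqs set0 b (if i then z \o inl else z \o inr).
  by move=> E; apply: pz0; apply: eqs_trans Ez0 _; exact: eqs_jnr E.
have si0 i : semi_isolates b (if i then z0 \o inl else z0 \o inr).
  pose side (z : P + P -> U) : P -> U := if i then z \o inl else z \o inr.
  pose other (x y : P -> U) : P + P -> U := if i then jn y x else jn x y.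
  exists (fun z => exists w, chi (jn (z \o inl) (other w (z \o inr)))); split.
  - pose r (z : P + (P + P)) : P + (P + P) := match z with
      | inl j => inr (inl j)
      | inr (inl j) => if i then inr (inr j) else inl j
      | inr (inr j) => if i then inl j else inr (inr j) end.
    apply: (@DB_ex _ _ set0 _ P (fun z => chi (jn (z \o inr \o inl) (other (z \o inl) (z \o inr \o inr))))).
    apply: DB_ext (DB_reind r Dchi) => z.
    suff -> : z \o r = jn (z \o inr \o inl) (other (z \o inl) (z \o inr \o inr)) by [].
    by apply/funext; rewrite /other /r; case: (i) => -[|[]].
  - exists (if i then z0 \o inr else z0 \o inl).
    suff -> : other (if i then z0 \o inr else z0 \o inl)
      (jn b (if i then z0 \o inl else z0 \o inr) \o inr) = z0 by [].
    by rewrite /other; apply/funext; case: (i) => -[].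
  - move=> c' e' pc' [w Hw].
    have [w' Ew'] := homogeneousl cU (other w e') c0 (eqs_sym pc').
    have E := Hchi w' (Ew' chi Dchi Hw).
    have {}E : eqs set0 (jn b e0) (other w e') by apply: eqs_trans E (eqs_sym (eqs_jnr Ew')).
    have := pz0 i _ E; congr (eqs set0 b _).
    by rewrite /other; apply/funext; case: (i).
have slink c z i : link c z -> semi_isolates c (if i then z \o inl else z \o inr).
  move=> E; apply: semi_isolates_conj (si0 i).
  pose r (k : P + P) : P + (P + P) := match k with
    | inl j => inl j | inr j => inr (if i then inl j else inr j) end.
  have Er (x : P -> U) (y : P + P -> U) : jn x y \o r = jn x (if i then y \o inl else y \o inr).
    by apply/funext; rewrite /r; case: (i) => -[].
  by have := eqs_reind r E; rewrite !Er.
have nlink c z : link c z -> nd set0 (z \o inl) (z \o inr).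
  move=> E; apply: (@nd_conj _ _ _ _ _ b _ e0); last exact: nd_sym.
  rewrite jn_eta; apply: eqs_trans Ez0 _; exact: eqs_jnr E.
pose top (s : seq (P + P -> U)) := last b [seq z \o inl | z <- s].
pose hs (s : seq (P + P -> U)) (q : 'I_(size s) * P) : U :=
  nth b [seq z \o inr | z <- s] q.1 q.2.
(* Independence of [top s] from the right halves so far is the invariant that makes the next right
   half independent of them as well. *)
pose good (s : seq (P + P -> U)) :=
  [/\ eqs set0 b (top s), semi_isolates b (top s) & nd set0 (top s) (@hs s)].
pose Q s z := good s -> [/\ link (top s) z, nd set0 (z \o inr) (@hs s) & good (rcons s z)].
have [s|g Hg] := @seq_build _ Q.
  have [gs|ngs] := lem (good s); last by exists z0.
  have [pt st nt] := gs.
  have [z1 Ez1] := homogeneousl cU z0 c0 pt.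
  have ct : ctbl (set0 `|` range (top s)) by exact: ctblU c0 (ctbl_range _).
  have [z [Ez nz]] := nd_exists cU lcU z1 (@hs s) ct.
  have Lz : link (top s) z.
    apply: eqs_trans Ez1 _; apply: eqs_swap; exact/eqs_ext.
  (* [z] is independent of the right halves over [top s]; left transitivity with [nt] removes
     [top s] from the base. *)
  have ntz : nd set0 z (@hs s).
    apply: nd_subl (nd_jnl cU c0 nt nz); rewrite range_jn; exact: subsetUr.
  exists z => _; split=> //.
    apply: nd_subl ntz => _ [j _ <-]; by exists (inr j).
  have topE : top (rcons s z) = z \o inl by rewrite /top map_rcons last_rcons.
  split; rewrite topE.
  - exact: (zlink _ _ true Lz).
  - exact: semi_isolates_trans st (slink _ _ true Lz).
  - have nj : nd set0 (z \o inl) (jn (z \o inr) (@hs s)).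
      apply: nd_jnr => //; first exact: nlink Lz.
      by apply: nd_basel => //; rewrite jn_eta.
    apply: (nd_sub cU c0 _ nj) => u [[j c] _ <-]; rewrite range_jn /hs /=.
    have jlt : j <= size s by rewrite -ltnS -(size_rcons s z) ltn_ord.
    move: (nat_of_ord j) jlt => {}j; rewrite leq_eqVlt map_rcons nth_rcons size_map.
    case/orP => [/eqP ->|js]; first by rewrite ltnn eqxx; left; exists c.
    by rewrite js; right; exists (Ordinal js, c).
have gg n : good (mkseq g n).
  elim: n => [|n IH]; last by rewrite mkseqS; have [] := Hg n IH.
  split=> //; first exact: semi_isolates_refl.
  (* There are no right halves yet, so all terms of a supposed dividing sequence are the empty tuple
     and [b] satisfies every instance. *)
  move=> R DR Rb k [bs [_ K]]; apply: (K (iota 0 k)); rewrite ?iota_uniq ?size_iota //.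
  exists b => t _; move: Rb; congr (R (jn _ _)).
  by apply/funext => -[[]].
pose e n := g n \o inr.
have [n Hn] : exists n, nd (set0 `|` upto e n) b (e n).
  apply: contrapT => N; apply: (@no_dividing_chain L U cU lcU P P set0 b e c0) => i.
  apply: contrapT => N'; apply: N; exists i => R DR Rb k Dv; apply: N'; by exists R, k.
have [Ln nen _] := Hg n (gg n); have [_ sn _] := gg n.
have Er : upto e n = range (@hs (mkseq g n)).
  apply/seteqP; split=> u.
    move=> [j jn [c _ <-]].
    have js : j < size (mkseq g n) by rewrite size_mkseq.
    exists (Ordinal js, c) => //.
    by rewrite /hs /= (nth_map (g 0)) // nth_mkseq.
  move=> [[j c] _ <-]; have jn : j < n by rewrite -[X in _ < X](size_mkseq g n) ltn_ord.
  exists (nat_of_ord j) => //; exists c => //.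
  by rewrite /hs /= (nth_map (g 0)) ?size_mkseq // nth_mkseq.
rewrite Er in Hn.
have ch : ctbl (set0 `|` range (@hs (mkseq g n))) by exact: ctblU c0 (ctbl_range _).
have := nd_jnr cU lcU c0 nen (nd_sym cU lcU ch Hn).
move=> /(nd_sub cU c0 (b' := b)) H.
have {}H : nd set0 (e n) b by apply: H; rewrite range_jn; exact: subsetUr.
apply: (@semi_isolates_dependent b (e n)) => //; last exact: nd_sym.
exact: semi_isolates_trans sn (slink _ _ false Ln).
Qed.

End SemiIsolation.

(** * Countable models *)

Section Isomorphism.
Variable L : language.
Implicit Types (M N : struc L).

Lemma isomorphic_sym M N : isomorphic M N -> isomorphic N M.
Proof.
move=> [h [h' [hK [h'K [Hf Hr]]]]]; exists h', h; split=> //; split=> //; split=> [f args|r args].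
  apply: (can_inj hK); rewrite h'K Hf; congr (fint N f _).
  by apply/funext => i; rewrite h'K.
apply: iff_sym; apply: iff_trans (Hr _ _) _.
by have -> : (fun i => h (h' (args i))) = args by apply/funext => i; rewrite h'K.
Qed.

Lemma isomorphic_sat M N : isomorphic M N -> exists h : M -> N,
  forall phi (e : nat -> M), sat e phi <-> sat (h \o e) phi.
Proof.
move=> [h [h' [hK [h'K [Hf Hr]]]]]; exists h.
have He (e : nat -> M) t : h (eval e t) = eval (h \o e) t.
  elim: t => [//|f args IH] /=; rewrite Hf; congr (fint N f _); exact/funext.
elim=> [|t1 t2|r args|p IHp q IHq|v p IHp] e /=.
- by [].
- by rewrite -!He; split=> [->|/(can_inj hK)].
- apply: iff_trans (Hr _ _) _.
  by have -> : (fun i => h (eval e (args i))) = (fun i => eval (h \o e) (args i)) by exact/funext.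
- by have := IHp e; have := IHq e; tauto.
- have K x : sat (upd e v x) p <-> sat (upd (h \o e) v (h x)) p.
    apply: iff_trans (IHp _) _; apply: sat_agree => w _.
    by rewrite /upd /=; case: eqP.
  split=> H x; last exact/K.
  by rewrite -(h'K x); apply/K.
Qed.

Definition same_type_across M N (I : Type) (a : I -> M) (b : I -> N) : Prop :=
  forall phi (s : nat -> option I), (forall v, free v phi -> s v <> None) ->
    sat (fun v => oapp a (witness M) (s v)) phi <-> sat (fun v => oapp b (witness N) (s v)) phi.

Definition realizes M N (I : Type) (b : I -> N) : Prop :=
  exists a : I -> M, same_type_across a b.

Lemma same_type_across_elem M N (I : Type) (h : M -> N) (a : I -> M) :
  (forall phi (e : nat -> M), sat e phi <-> sat (h \o e) phi) -> same_type_across a (h \o a).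
Proof.
move=> H phi s Hs; apply: iff_trans (H _ _) _; apply: sat_agree => v /Hs /=.
by case: (s v).
Qed.

Lemma same_type_across_trans M N (K : struc L) (I : Type) (a : I -> M) (b : I -> N) (c : I -> K) :
  same_type_across a b -> same_type_across b c -> same_type_across a c.
Proof. by move=> H1 H2 phi s Hs; apply: iff_trans (H1 phi s Hs) (H2 phi s Hs). Qed.

Lemma same_type_across_sym M N (I : Type) (a : I -> M) (b : I -> N) :
  same_type_across a b -> same_type_across b a.
Proof. by move=> H phi s Hs; apply: iff_sym; exact: H. Qed.

Lemma realizes_reind M N (I J : Type) (b : J -> N) (r : I -> J) :
  realizes M b -> realizes M (b \o r).
Proof.
move=> [a H]; exists (a \o r) => phi s Hs.
have := H phi (omap r \o s); have E T (d : T) (c : J -> T) :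
  (fun v => oapp c d ((omap r \o s) v)) = (fun v => oapp (c \o r) d (s v)).
  by apply/funext => v /=; case: (s v).
by rewrite !E; apply => v /Hs /=; case: (s v).
Qed.

Lemma same_type_across_eqs M (I : Type) (a b : I -> M) :
  same_type_across a b -> eqs set0 a b.
Proof.
move=> H R [phi [s [F S]]] /S Ra; apply/S.
pose s' v := if s v is Some (inl i) then Some i else None.
have E c : sat (fun v => oval c (s v)) phi <-> sat (fun v => oapp c (witness M) (s' v)) phi.
  by apply: sat_agree => v /F; rewrite /s'; case: (s v) => [[]|].
apply/E; apply/(H phi s'); last exact/E.
by move=> v /F; rewrite /s'; case: (s v) => [[]|].
Qed.

End Isomorphism.

Section CompleteTheory.
Variables (L : language) (T : theory L).
Hypothesis completeT : complete_theory T.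

Lemma satisfiable_transfer (M N : struc L) phi : is_model T M -> is_model T N ->
  (exists e : nat -> M, sat e phi) -> exists e : nat -> N, sat e phi.
Proof.
move=> HM HN [e He]; have [_ [_ dec]] := completeT.
have [sg [F S]] := exists_block phi (iota 0 (formula_bound phi)).
have sgS : sentence sg.
  move=> v /F [/formula_boundP vb]; by rewrite mem_iota /= add0n vb.
have Msg : sat e sg.
  apply/S; exists e; apply: sat_agree1 He => v _; by case: ifP.
have [H|H] := dec sg sgS; last by case: (H M HM e Msg).
by have /S[h Hh] := H N HN (fun _ => witness N); eexists; exact: Hh.
Qed.

Lemma valid_transfer (M N : struc L) phi : is_model T M -> is_model T N ->
  (forall e : nat -> M, sat e phi) -> forall e : nat -> N, sat e phi.
Proof.
move=> HM HN H e; apply: contrapT => ne.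
have [|e' He'] := @satisfiable_transfer N M (Neg phi) HN HM; first by exists e.
exact: He' (H e').
Qed.

Definition isolated_types (M : struc L) : Prop :=
  forall n (a : nat -> M), exists theta, [/\ forall v, free v theta -> v < n, sat a theta &
    forall phi, (forall v, free v phi -> v < n) -> sat a phi ->
      forall N, is_model T N -> forall e : nat -> N, sat e theta -> sat e phi].

Definition partial_elementary (M N : struc L) (s : seq (M * N)) : Prop :=
  forall phi, (forall v, free v phi -> v < size s) ->
    sat (fun v => (nth (witness M, witness N) s v).1) phi <->
    sat (fun v => (nth (witness M, witness N) s v).2) phi.

Lemma partial_elementary_swap (M N : struc L) (s : seq (M * N)) :
  partial_elementary s -> partial_elementary [seq (x.2, x.1) | x <- s].
Proof.
move=> H phi Hphi; have E v : nth (witness N, witness M) [seq (x.2, x.1) | x <- s] v =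
    ((nth (witness M, witness N) s v).2, (nth (witness M, witness N) s v).1).
  have [vs|vs] := ltnP v (size s); first by rewrite (nth_map (witness M, witness N)).
  by rewrite !nth_default ?size_map.
rewrite size_map in Hphi; apply: iff_trans (iff_trans (iff_sym (H phi Hphi)) _).
  by apply: sat_agree => v _; rewrite E.
by apply: sat_agree => v _; rewrite E.
Qed.

Lemma partial_elementary_forth (M N : struc L) (s : seq (M * N)) a :
  isolated_types M -> is_model T N -> partial_elementary s ->
  exists b, partial_elementary (rcons s (a, b)).
Proof.
move=> isoM HN Hs; pose d := (witness M, witness N); pose n := size s.
pose a' v := if v == n then a else (nth d s v).1.
have [theta [Ft Sa Ht]] := isoM n.+1 a'.
have : sat (fun v => (nth d s v).1) (Ex n theta).
  apply/sat_Ex; exists a; apply: sat_agree1 Sa => v _; by rewrite /a' /upd.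
have FEx v : free v (Ex n theta) -> v < n.
  by move=> [[nv [/Ft|//]]|//]; rewrite ltnS leq_eqVlt => /orP[/eqP|].
move/(Hs _ FEx)/sat_Ex => [b Sb]; exists b => phi; rewrite size_rcons => Fphi.
have E1 : sat (fun v => (nth d (rcons s (a, b)) v).1) phi <-> sat a' phi.
  apply: sat_agree => v /Fphi; rewrite ltnS leq_eqVlt nth_rcons /a' -/n.
  by case/orP => [/eqP ->|vn]; rewrite ?ltnn ?eqxx // vn ltn_eqF.
have E2 : sat (fun v => (nth d (rcons s (a, b)) v).2) phi <->
    sat (upd (fun v => (nth d s v).2) n b) phi.
  apply: sat_agree => v /Fphi; rewrite ltnS leq_eqVlt nth_rcons /upd -/n.
  by case/orP => [/eqP ->|vn]; rewrite ?ltnn ?eqxx // vn ltn_eqF.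
apply: iff_trans E1 _; apply: iff_trans (iff_sym E2); split=> H.
  exact: (Ht phi Fphi H N HN).
apply: contrapT => nH; have FN v : free v (Neg phi) -> v < n.+1 by move=> [/Fphi|].
exact: (Ht (Neg phi) FN nH N HN _ Sb H).
Qed.

Lemma partial_elementary_back (M N : struc L) (s : seq (M * N)) b :
  isolated_types N -> is_model T M -> partial_elementary s ->
  exists a, partial_elementary (rcons s (a, b)).
Proof.
move=> isoN HM /partial_elementary_swap /(partial_elementary_forth b isoN HM) [a].
move/partial_elementary_swap; rewrite map_rcons -map_comp /= => H; exists a.
by have -> : s = [seq ((x.1, x.2)) | x <- s]; [elim: (s) => //= -[x y] s' <-|].
Qed.

Lemma isolated_types_isomorphic (M N : struc L) : is_model T M -> is_model T N ->
  countable_struc M -> countable_struc N -> isolated_types M -> isolated_types N ->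
  isomorphic M N.
Proof.
move=> HM HN [eM eMI] [eN eNI] isoM isoN.
pose d := (witness M, witness N).
(* Back and forth: stage [2k] takes care of the element of [N] with code [k], stage [2k+1] of that
   of [M]. *)
pose Q (s : seq (M * N)) x := partial_elementary s -> partial_elementary (rcons s x) /\
  if odd (size s) then (forall a, eM a = (size s)./2 -> x.1 = a)
  else (forall b, eN b = (size s)./2 -> x.2 = b).
have [s|g Hg] := @seq_build _ Q.
  have [gs|ngs] := lem (partial_elementary s); last by exists d.
  case: (boolP (odd (size s))) => os.
    have [[a Ha]|na] := lem (exists a, eM a = (size s)./2).
      have [b Hb] := partial_elementary_forth a isoM HN gs; exists (a, b) => _.
      by rewrite os; split=> // a' Ha'; apply: eMI; rewrite Ha.
    have [b Hb] := partial_elementary_forth (witness M) isoM HN gs; exists (witness M, b) => _.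
    by rewrite os; split=> // a Ha; case: na; exists a.
  have [[b Hb]|nb] := lem (exists b, eN b = (size s)./2).
    have [a Ha] := partial_elementary_back b isoN HM gs; exists (a, b) => _.
    by rewrite (negbTE os); split=> // b' Hb'; apply: eNI; rewrite Hb.
  have [a Ha] := partial_elementary_back (witness N) isoN HM gs; exists (a, witness N) => _.
  by rewrite (negbTE os); split=> // b Hb; case: nb; exists b.
have gg n : partial_elementary (mkseq g n).
  elim: n => [|n IH]; last by rewrite mkseqS; have [] := Hg n IH.
  move=> phi F; have E (K : struc L) (e e' : nat -> K) : sat e phi -> sat e' phi.
    by apply: sat_agree1 => v /F.
  split=> H.
    by have [|e He] := satisfiable_transfer HM HN (phi := phi); [eexists; exact: H|exact: E He].
  by have [|e He] := satisfiable_transfer HN HM (phi := phi); [eexists; exact: H|exact: E He].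
(* Variable [v] names the pair [g v], so all clauses of the isomorphism become atomic instances of
   this equivalence. *)
have G phi : sat (fun v => (g v).1) phi <-> sat (fun v => (g v).2) phi.
  have := gg (formula_bound phi) phi; rewrite size_mkseq => /(_ (@formula_boundP _ phi)) H.
  have E v : free v phi -> nth d (mkseq g (formula_bound phi)) v = g v.
    by move=> /formula_boundP vn; rewrite nth_mkseq.
  by apply: iff_trans (iff_trans (iff_sym _) H) _; apply: sat_agree => v /E ->.
pose i a := (eM a).*2.+1; pose j b := (eN b).*2.
have gi a : (g (i a)).1 = a.
  have [_] := Hg (i a) (gg (i a)).
  by rewrite size_mkseq /i /= odd_double /= uphalf_double; apply.
have gj b : (g (j b)).2 = b.
  have [_] := Hg (j b) (gg (j b)).
  by rewrite size_mkseq /j /= odd_double /= doubleK; apply.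
have geq m n : (g m).1 = (g n).1 <-> (g m).2 = (g n).2 := G (Eqf (Var L m) (Var L n)).
exists (fun a => (g (i a)).2), (fun b => (g (j b)).1).
split; first by move=> a; rewrite -[RHS]gi; apply/geq; rewrite gj.
split; first by move=> b; rewrite -[RHS]gj; apply/geq; rewrite gi.
split=> [f args|r args].
  apply: (proj1 (G (Eqf (Var L (i (fint M f args))) (App (fun k => Var L (i (args k))))))).
  by rewrite /= gi; congr (fint M f _); apply/funext => k; rewrite gi.
apply: iff_trans (G (Rel (fun k => Var L (i (args k))))) => /=.
by have -> : (fun k => (g (i (args k))).1) = args by apply/funext => k; rewrite gi.
Qed.

End CompleteTheory.

(** * Omitting types *)

Section OmittingTypes.
Variables (L : language) (U : struc L).
Hypotheses (ctbL : countable_language L) (cU : compact U).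

(** A Rasiowa-Sikorski argument: conditions are satisfiable predicates over [B], the requirements
    [D t] are met one after another, and saturation gives a point in the whole decreasing
    sequence. *)
Lemma generic_point (T : countType) (B : set U) (Phi0 : (nat -> U) -> Prop)
    (D : T -> ((nat -> U) -> Prop) -> Prop) :
  ctbl B -> DB B Phi0 -> (exists f, Phi0 f) ->
  (forall t Phi, DB B Phi -> (exists f, Phi f) -> exists Phi',
     [/\ DB B Phi', exists f, Phi' f, forall f, Phi' f -> Phi f & D t Phi']) ->
  exists f, Phi0 f /\ forall t, exists Phi, D t Phi /\ Phi f.
Proof.
move=> cB D0 S0 dense.
have step (x : nat * ((nat -> U) -> Prop)) : exists Phi', DB B x.2 /\ (exists f, x.2 f) ->
    [/\ DB B Phi', exists f, Phi' f, forall f, Phi' f -> x.2 f &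
     forall t, unpickle x.1 = Some t -> D t Phi'].
  case: x => n Phi /=; have [[DP SP]|nP] := lem (DB B Phi /\ (exists f, Phi f)); last by exists Phi.
  case E : (unpickle n) => [t|]; last by exists Phi.
  have [Phi' [? ? ? ?]] := dense t Phi DP SP.
  by exists Phi' => _; split=> // t' [<-].
have [F HF] := choice step.
pose fix Phi n := if n is m.+1 then F (m, Phi m) else Phi0.
have good n : DB B (Phi n) /\ exists f, Phi n f.
  by elim: n => // n IH; have [] := HF (n, Phi n) IH.
have dec m n f : m <= n -> Phi n f -> Phi m f.
  elim: n => [|n IH]; first by rewrite leqn0 => /eqP ->.
  rewrite leq_eqVlt => /orP[/eqP -> //|]; rewrite ltnS => /IH H.
  by have [_ _ H' _] := HF (n, Phi n) (good n); move/H'.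
have [] := cU (B := B) (G := fun Q => exists n, Q = Phi n) cB.
- by move=> Q [n ->]; have [] := good n.
- move=> l lG.
  have [n Hn] : exists n, forall Q, In Q l -> exists2 m, m <= n & Q = Phi m.
    elim: l lG => [|Q l IH] lG; first by exists 0.
    have [|n Hn] := IH; first by move=> P Pl; apply: lG; right.
    have [m Qm] := lG Q (or_introl erefl).
    exists (maxn m n) => P [<-|/Hn [m' m'n PE]].
      by exists m => //; exact: leq_maxl.
    by exists m' => //; apply: leq_trans m'n (leq_maxr _ _).
  have [_ [f Hf]] := good n.
  by exists f => Q /Hn [m mn ->]; exact: dec mn Hf.
move=> f Hf; exists f; split; first by apply: Hf; exists 0.
move=> t; exists (Phi (pickle t).+1); split; last by apply: Hf; exists (pickle t).+1.
by have [_ _ _] := HF (pickle t, Phi (pickle t)) (good _); apply; rewrite /= pickleK.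
Qed.

(* Tarski-Vaught: the range of [f] is the universe of an elementary substructure. *)
Definition tarski_vaught (f : nat -> U) : Prop :=
  forall R : (unit + nat -> U) -> Prop, DB set0 R ->
    (exists x : unit -> U, R (jn x f)) -> exists n, R (jn (fun _ => f n) f).

Lemma omitting_types (P M : finType) (b : P -> U) (e : M -> U) :
  exists f, [/\ tarski_vaught f, forall i, f (pickle i) = b i &
    ~ (exists chi : (P + M -> U) -> Prop,
        [/\ DB set0 chi, exists z, chi (jn b z) & forall z, chi (jn b z) -> eqs set0 e z]) ->
    forall t : M -> nat, ~ eqs set0 e (f \o t)].
Proof.
set NSI := ~ _.
(* It is enough to treat parameter-free predicates, because the values of [f] act as the
   parameters. *)
have [R HR] := DB_enum ctbL (unit + nat)%type (fun _ => witness U).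
pose Phi0 (f : nat -> U) := forall i, i \in enum P -> f (pickle i) = b i.
pose B := range b.
have DPhi0 : DB B Phi0.
  apply: DB_all_in => i _.
  exact: (@DB_spec _ _ B nat P (fun z => z (inl (pickle i)) = z (inr i)) b _ (DB_eq _ _ _)).
pose D (t : nat + {ffun M -> nat}) (Phi : (nat -> U) -> Prop) : Prop :=
  match t with
  | inl n => DB set0 (R n) -> exists w, forall f, Phi f ->
      (exists x : unit -> U, R n (jn x f)) -> R n (jn (fun _ => f w) f)
  | inr t => NSI -> forall f, Phi f -> ~ eqs set0 e (f \o t)
  end.
have [|t Phi DPhi SPhi|f [f0 Hf]] := @generic_point _ B Phi0 D (ctbl_range b) DPhi0.
- exists (fun n => if unpickle n is Some i then b i else witness U) => i _.
  by rewrite pickleK.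
- case: t => [n|t] /=.
    have [DR|nDR] := lem (DB set0 (R n)); last by exists Phi.
    have [N1 H1] := DB_finite_support DPhi.
    have [phi [s [F S]]] := DR.
    pose N2 := \max_(v < formula_bound phi) (if s v is Some (inl (inr i)) then i.+1 else 0).
    (* Neither [Phi] nor [R n] depends on this index, so the witness can be placed there freely. *)
    pose w := maxn N1 N2.
    have Rw (x y : unit -> U) (f g : nat -> U) : x = y -> (forall i, i < w -> f i = g i) ->
        R n (jn x f) -> R n (jn y g).
      move=> -> H /S Hx; apply/S; apply: sat_agree1 Hx => v Fv.
      case E : (s v) => [[[u|i]|u]|] //=; apply: H.
      rewrite leq_max; apply/orP; right.
      have /= := leq_bigmax (F := fun v : 'I__ => if s v is Some (inl (inr i)) then i.+1 else 0)
        (Ordinal (formula_boundP Fv)).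
      by rewrite E.
    exists (fun f => Phi f /\ ((exists x : unit -> U, R n (jn x f)) -> R n (jn (fun _ => f w) f))).
    split; last by move=> _; exists w => f [].
    + apply: DB_and => //.
      have DR' : DB B (R n) by apply: DB_mono DR; exact: sub0set.
      apply: DB_imp; first exact: (@DB_ex _ _ B nat unit).
      pose r (z : unit + nat) := match z with inl _ => w | inr i => i end.
      apply: DB_ext (DB_reind r DR') => f.
      suff -> : f \o r = jn (fun _ => f w) f by [].
      by apply/funext => -[].
    + have [f Pf] := SPhi.
      have [[x Rx]|nx] := lem (exists x : unit -> U, R n (jn x f)); last by exists f.
      exists (upd f w (x tt)).
      have agr i : i < w -> f i = upd f w (x tt) i by rewrite /upd => iw; rewrite ltn_eqF.
      split.
        apply: (proj1 (H1 f _ _)) Pf => i iN; apply: agr; apply: leq_trans iN _; exact: leq_maxl.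
      move=> _; apply: Rw Rx => //.
      by apply/funext => -[]; rewrite /upd eqxx.
    + by move=> f [].
  have [nsi|si] := lem NSI; last by exists Phi.
  (* Otherwise the projection of [Phi] to the coordinates [t] would be a satisfiable predicate over
     [b] implying the type of [e], against [NSI]. *)
  have [z [Hz nez]] : exists z, (exists f, Phi f /\ f \o t = z) /\ ~ eqs set0 e z.
    apply: contrapT => N; apply: nsi.
    have Dchi : DB B (fun z : M -> U => exists f, Phi f /\ forall i, i \in enum M -> f (t i) = z i).
      apply: (@DB_ex _ _ B M nat (fun y => Phi (y \o inl) /\ forall i, i \in enum M -> y (inl (t i)) = y (inr i))).
      apply: DB_and; first exact: (DB_reind inl DPhi).
      by apply: DB_all_in => i _; exact: DB_eq.
    have eqt (f : nat -> U) (z : M -> U) : (forall i, i \in enum M -> f (t i) = z i) -> f \o t = z.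
      by move=> H; apply/funext => i; apply: H; rewrite mem_enum.
    rewrite -[B]set0U in Dchi; have [chi [Dc Hc]] := DB_abs Dchi.
    exists (fun z => chi (jn (z \o inr) (z \o inl))); split.
    + apply: DB_ext (DB_reind (@swap M P) Dc) => z.
      by have -> : z \o @swap M P = jn (z \o inr) (z \o inl) by apply/funext => -[].
    + by have [f Pf] := SPhi; exists (f \o t); apply/Hc; exists f.
    + move=> z /Hc [f [Pf /eqt fz]]; apply: contrapT => nez; apply: N.
      by exists z; split=> //; exists f.
  have [f [Pf ftz]] := Hz.
  have /existsNP[S /not_implyP[DS /not_implyP[Se nSz]]] := nez.
  exists (fun f => Phi f /\ ~ S (f \o t)); split.
  + by apply: DB_and => //; apply: DB_not; apply: DB_reind; apply: DB_mono DS; exact: sub0set.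
  + by exists f; rewrite ftz.
  + by move=> g [].
  + by move=> _ g [_ nS] /(_ S DS Se).
exists f; split.
- move=> Q DQ [x Qx].
  have [n nQ] : exists n, R n = Q by apply: HR; apply: DB_mono DQ; exact: sub0set.
  have [Phi [/= H Pf]] := Hf (inl n); rewrite nQ in H.
  have [w Hw] := H DQ; exists w; apply: Hw => //; by exists x.
- by move=> i; apply: f0; rewrite mem_enum.
- move=> nsi t; have [Phi [/= H Pf]] := Hf (inr (finfun t)).
  have := H nsi f Pf; suff -> : f \o (finfun t) = f \o t by [].
  by apply/funext => i /=; rewrite ffunE.
Qed.

Section Substructure.
Variables (f : nat -> U) (tvf : tarski_vaught f).

Definition sub_carrier := {u : U | range f u}.

Lemma sub_carrier_inj (x y : sub_carrier) : sval x = sval y -> x = y.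
Proof. by case: x y => [u p] [v q] /= E; exact: eq_exist. Qed.

Lemma range_fint F (args : 'I_(farity F) -> U) : (forall i, range f (args i)) ->
  range f (fint U F args).
Proof.
move=> H; have H' i : exists n, f n = args i by have [n _ <-] := H i; exists n.
have [n Hn] := choice H'.
pose R (z : unit + nat -> U) := z (inl tt) = fint U F (fun i => z (inr (n i))).
have [||m /= Hm] := tvf (R := R).
- exists (Eqf (Var L 0) (App (fun i : 'I_(farity F) => Var L i.+1))),
    (fun v => if v is i.+1 then
       if insub i is Some j then Some (inl (inr (n (j : 'I_(farity F))))) else None
     else Some (inl (inl tt))); split.
    by move=> v /= [->|[i ->]] //; rewrite valK.
  move=> z /=; rewrite /R.
  by have -> : (fun i => oval z (if insub (nat_of_ord i) is Some j
     then Some (inl (inr (n (j : 'I_(farity F))))) else None)) = (fun i => z (inr (n i)))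
    by apply/funext => i; rewrite valK.
- by exists (fun _ => fint U F (fun i => f (n i))).
exists m => //; apply: etrans Hm _; congr (fint U F _); exact/funext.
Qed.

Definition substructure : struc L := {|
  carrier := sub_carrier;
  witness := exist (range f) (f 0) (ex_intro2 _ _ 0 I erefl);
  fint := fun F args => exist (range f) (fint U F (fun i => sval (args i)))
    (range_fint (fun i => svalP (args i)));
  rint := fun r args => rint U r (fun i => sval (args i)) |}.

Lemma substructure_elementary phi (e : nat -> substructure) :
  sat e phi <-> sat (fun v => sval (e v)) phi.
Proof.
have He (e' : nat -> substructure) t : sval (eval e' t) = eval (fun v => sval (e' v)) t.
  elim: t => [//|F args IH] /=; congr (fint U F _); exact/funext.
elim: phi e => [|t1 t2|r args|p IHp q IHq|v p IHp] e /=.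
- by [].
- rewrite -!He; split=> [->//|E]; exact: sub_carrier_inj.
- by have -> : (fun i => sval (eval e (args i))) =
    (fun i => eval (fun v => sval (e v)) (args i)) by apply/funext => i.
- by have := IHp e; have := IHq e; tauto.
- have K x : sat (upd e v x) p <-> sat (upd (fun v => sval (e v)) v (sval x)) p.
    apply: iff_trans (IHp _) _; apply: sat_agree => w _.
    by rewrite /upd /=; case: eqP.
  split=> H x; last exact/K.
  apply: contrapT => nx.
  have k w : exists n, f n = sval (e w) by have [n _ ?] := svalP (e w); exists n.
  have [n Hn] := choice k.
  pose R (z : unit + nat -> U) := ~ sat (fun w => if w == v then z (inl tt) else z (inr (n w))) p.
  have [||m] := tvf (R := R).
  + apply: DB_not; exists p, (fun w => if w == v then Some (inl (inl tt)) else Some (inl (inr (n w)))).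
    split=> [w _|z]; first by case: eqP.
    by apply: sat_agree => w _; case: eqP.
  + exists (fun _ => x) => /= Hx; apply: nx; apply: sat_agree1 Hx => w _.
    by rewrite /upd; case: eqP => // _; exact: Hn.
  apply.
  have fm : range f (f m) by exists m.
  have /K := H (exist _ (f m) fm); apply: sat_agree1 => w _.
  by rewrite /upd /=; case: eqP => // _; exact: esym (Hn _).
Qed.

Lemma substructure_countable : countable_struc substructure.
Proof.
have H (x : substructure) : exists n, f n = sval x by have [n _ ?] := svalP x; exists n.
have [enc Henc] := choice H; exists enc => x y E.
by apply: sub_carrier_inj; rewrite -!Henc E.
Qed.

Lemma substructure_model (T : theory L) : is_model T U -> is_model T substructure.
Proof. by move=> HU phi /HU H e; apply/substructure_elementary. Qed.

End Substructure.

(** An enumeration of [N] is read as an assignment, and [U] realizes its type: completeness of [T]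
    transfers finite satisfiability. *)
Lemma countable_model_embeds (T : theory L) (N : struc L) : complete_theory T -> is_model T U ->
  is_model T N -> countable_struc N ->
  exists g : N -> U, forall phi (e : nat -> N), sat e phi <-> sat (g \o e) phi.
Proof.
move=> cT HU HN [enc encI].
pose en n : N := match pselect (exists x, enc x = n) with
  | left E => projT1 (cid E) | right _ => witness N end.
have enK x : en (enc x) = x.
  rewrite /en; case: pselect => [E|[]]; last by exists x.
  by case: (cid E) => /= y /encI.
have [] := cU (I := nat) (B := set0) (G := fun Q => exists phi, sat en phi /\ Q = (fun x => sat x phi)).
- exact: ctbl0.
- by move=> Q [phi [_ ->]]; exists phi, (fun v => Some (inl v)).
- move=> l lG.
  have [phi [enphi Hphi]] : exists phi, sat en phi /\
      forall x : nat -> U, sat x phi -> forall Q, In Q l -> Q x.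
    elim: l lG => [|Q l IH] lG; first by exists (Neg (Fals L)); split=> // [[]].
    have [|phi [enphi Hphi]] := IH; first by move=> P Pl; apply: lG; right.
    have [psi [enpsi QE]] := lG Q (or_introl erefl).
    exists (Neg (Imp phi (Neg psi))); split=> [H|x Hx P]; first exact: (H enphi enpsi).
    have [xphi xpsi] : sat x phi /\ sat x psi.
      by split; apply: contrapT => N1; apply: Hx => /=; [move=> /N1|move=> _ /N1].
    by case=> [<-|]; [rewrite QE|exact: Hphi].
  have [|x Hx] := satisfiable_transfer cT HN HU (phi := phi); first by exists en.
  by exists x; exact: Hphi.
move=> x Hx.
have Hx' phi : sat en phi <-> sat x phi.
  split=> H; first by apply: (Hx (fun x => sat x phi)); exists phi.
  apply: contrapT => nH.
  have : sat x (Neg phi) by apply: (Hx (fun x => sat x (Neg phi))); exists (Neg phi).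
  by move/(_ H).
exists (fun u => x (enc u)) => phi e.
have [phi' [_ S]] := rename_formula phi (fun v => enc (e v)).
have := Hx' phi'; rewrite (propext (S _ _)) (propext (S _ _)).
suff -> : en \o (fun v => enc (e v)) = e by [].
by apply/funext => v /=; rewrite enK.
Qed.

End OmittingTypes.

(** * Finitely many countable models *)

Section FinitelyMany.
Variables (L : language) (T : theory L).
Hypotheses (ctbL : countable_language L) (completeT : complete_theory T).
Variable U : struc L.
Hypotheses (HU : is_model T U) (cU : compact U).

Lemma isolated_types_model (N : struc L) : is_model T N -> countable_struc N ->
  (forall (M : finType) (e : M -> U), exists chi,
     [/\ DB set0 chi, chi e & forall z, chi z -> eqs set0 e z]) ->
  isolated_types T N.
Proof.
move=> HN cN iso n a.
have [g Hg] := countable_model_embeds cU completeT HU HN cN.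
have [chi [[phi0 [s [F S]]] chie Hchi]] := iso _ (fun i : 'I_n => g (a i)).
pose rho v := if s v is Some (inl i) then nat_of_ord i else 0.
have [theta [Ft St]] := rename_formula phi0 rho.
have E (e : nat -> U) : sat e theta <-> chi (fun i => e i).
  apply: iff_trans (St _ _) _; apply: iff_trans (iff_sym (S _)).
  by apply: sat_agree => v /F; rewrite /rho /=; case: (s v) => [[]|].
exists theta; split.
- move=> v /Ft [w Fw ->]; rewrite /rho; have := F w Fw.
  by case: (s w) => [[i|]|] //= _; exact: ltn_ord.
- by apply/Hg/E.
move=> phi Fphi aphi N' HN'.
apply: (valid_transfer completeT HU HN' (phi := Imp theta phi)) => e /= /E /Hchi H.
pose R (z : 'I_n -> U) := sat (fun v => oval z (if insub v is Some i then Some (inl i) else None)) phi.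
have DR : DB set0 R.
  exists phi, (fun v => if insub v is Some i then Some (inl i) else None); split=> // v Fv.
  by rewrite (@insubT _ (fun v => v < n) _ v (Fphi v Fv)).
have ER (e' : nat -> U) : R (fun i => e' i) <-> sat e' phi.
  by apply: sat_agree => v Fv; rewrite (@insubT _ (fun v => v < n) _ v (Fphi v Fv)).
by apply/ER; apply: H => //; apply/(ER (g \o a))/Hg.
Qed.

(** If [theta] isolates the type of [b], the parameter in the formula over [b] can be quantified out
    within [theta]. *)
Lemma isolated_all_isolated (P : finType) (b : P -> U) : powerful b -> ~ nonisolated b ->
  forall (M : finType) (e : M -> U), exists chi,
    [/\ DB set0 chi, chi e & forall z, chi z -> eqs set0 e z].
Proof.
move=> pow niso M e.
have [theta [Dt tb Ht]] : exists theta, [/\ DB set0 theta, theta b & forall c, theta c -> eqs set0 b c].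
  apply: contrapT => N; apply: niso => th Dth thb; apply: contrapT => N'; apply: N.
  exists th; split=> // c thc; apply: contrapT => nc; apply: N'; by exists c.
have [chi [Dc [z0 Hz0] Hc]] := pow M e.
pose psi z := exists x, theta x /\ chi (jn x z).
have Dpsi : DB set0 psi.
  apply: (@DB_ex _ _ set0 M P (fun y => theta (y \o inl) /\ chi (jn (y \o inl) (y \o inr)))).
  apply: DB_and; first exact: (DB_reind inl Dt).
  by apply: DB_ext Dc => y; rewrite jn_eta.
have Hpsi z : psi z -> eqs set0 e z.
  move=> [x [/Ht bx Hx]].
  have [z' Ez'] := homogeneousl cU z (@ctbl0 L U) (eqs_sym bx).
  apply: eqs_trans (Hc z' (Ez' _ Dc Hx)) _; exact: eqs_sym (eqs_jnr Ez').
exists psi; split=> //.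
by apply: (eqs_sym (Hc z0 Hz0) Dpsi); exists b.
Qed.

Lemma countable_model_exists : exists M : struc L, is_model T M /\ countable_struc M.
Proof.
pose b (i : 'I_0) : U := witness U.
have [f [tvf _ _]] := omitting_types ctbL cU b b.
exists (substructure tvf); split; first exact: substructure_model.
exact: substructure_countable.
Qed.

(* Let [b] realize, for each of the countable models that omit some type, a type that it omits. A countable model containing [b] and omitting [tp(e)] cannot exist, and the omitting types theorem concludes. *)
Lemma powerful_exists (k : nat) (Ms : nat -> struc L) :
  (forall N : struc L, is_model T N -> countable_struc N ->
     exists i, i < k /\ isomorphic N (Ms i)) ->
  exists (P : finType) (b : P -> U), powerful b.
Proof.
move=> Hall.
(* A structure that omits no type contributes the empty tuple; [P] below indexes the concatenation
   of all these tuples. *)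
have om (i : 'I_k) : exists me : {m : nat & 'I_m -> U},
    (exists m (e : 'I_m -> U), ~ realizes (Ms i) e) -> ~ realizes (Ms i) (projT2 me).
  have [[m [e ne]]|n] := lem (exists m (e : 'I_m -> U), ~ realizes (Ms i) e).
    by exists (existT _ m e).
  by exists (existT _ 0 (fun _ => witness U)).
have [me Hme] := choice om.
pose P : finType := {i : 'I_k & 'I_(projT1 (me i))}.
pose b (x : P) : U := projT2 (me (tag x)) (tagged x).
exists P, b => M e; apply: contrapT => nsi.
have [f [tvf fb fe]] := omitting_types ctbL cU b e.
pose N := substructure tvf.
have HN : is_model T N by exact: substructure_model.
have [i [ik iso]] := Hall N HN (@substructure_countable _ _ _ tvf).
have eN J (a : J -> N) : same_type_across a (fun j => sval (a j) : U).
  by apply: same_type_across_elem; exact: substructure_elementary.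
have transfer (K K' : struc L) J (e' : J -> U) : isomorphic K K' -> realizes K e' -> realizes K' e'.
  move=> /isomorphic_sat [h Hh] [a Ha]; exists (h \o a).
  apply: same_type_across_trans Ha; apply: same_type_across_sym.
  exact: same_type_across_elem.
have nNe : ~ realizes N e.
  move=> [a Ha].
  have k' j : exists n, f n = sval (a j) by have [n _ ?] := svalP (a j); exists n.
  have [t Ht] := choice k'.
  apply: (fe nsi t); have -> : f \o t = (fun j => sval (a j)) by apply/funext => j; rewrite /= Ht.
  apply: same_type_across_eqs; apply: same_type_across_trans (eN _ a).
  exact: same_type_across_sym.
have nMe : ~ realizes (Ms i) (e \o enum_val : 'I_#|M| -> U).
  move=> H; apply: nNe; apply: transfer (isomorphic_sym iso) _.
  have := realizes_reind enum_rank H; congr (realizes (Ms i) _).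
  by apply/funext => j /=; rewrite enum_rankK.
have nMi := Hme (Ordinal ik) (ex_intro _ #|M| (ex_intro _ (e \o enum_val) nMe)).
apply: nMi; apply: transfer iso _.
pose x j : P := Tagged (fun i => 'I_(projT1 (me i))) (j : 'I_(projT1 (me (Ordinal ik)))).
have fm j : range f (projT2 (me (Ordinal ik)) j) by exists (pickle (x j)) => //; rewrite fb.
exists (fun j => exist (range f) _ (fm j) : N).
exact: (eN _ (fun j => exist (range f) _ (fm j))).
Qed.

End FinitelyMany.

(* The number of countable models of T up to isomorphism is 1 or infinite. *)
Theorem theorem1p2 (L : language) (T : theory L) :
  countable_language L -> complete_theory T -> no_finite_models T ->
  supersimple T ->
  ((exists M : struc L, is_model T M /\ countable_struc M) /\
   (forall M N : struc L, is_model T M -> countable_struc M ->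
      is_model T N -> countable_struc N -> isomorphic M N))
  \/
  (forall k : nat, exists Ms : nat -> struc L,
     (forall i, i < k -> is_model T (Ms i) /\ countable_struc (Ms i)) /\
     (forall i j, i < k -> j < k -> i <> j -> ~ isomorphic (Ms i) (Ms j))).
Proof.
move=> ctbL completeT _ ssT.
set Q := (X in _ \/ forall k, X k).
have [|/existsNP [k nQk]] := lem (forall k, Q k); first by right.
have [_ [exM _]] := completeT.
have [U [HU cU]] := compact_model_exists ctbL exM.
have lcU : local_character U by move=> B n a; exact: ssT.
have [M0 [HM0 cM0]] := countable_model_exists ctbL HU cU.
(* A family that cannot be lengthened represents every countable model up to isomorphism. *)
have [n [[Ms [HMs nisoMs]] nQ]] : exists n, Q n /\ ~ Q n.+1.
  apply: contrapT => N; apply: nQk; elim: k => [|k IH].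
    by exists (fun _ => M0); split=> [i|i j]; rewrite ltn0.
  by apply: contrapT => nk; apply: N; exists k.
have Hall N : is_model T N -> countable_struc N -> exists i, i < n /\ isomorphic N (Ms i).
  move=> HN cN; apply: contrapT => nex; apply: nQ.
  exists (fun i => if i < n then Ms i else N); split=> [i _|i j].
    by case: ltnP => // /HMs.
  rewrite !ltnS => i_n j_n nij.
  case: (ltnP i n) => ni; case: (ltnP j n) => nj.
  - exact: nisoMs.
  - by move=> /isomorphic_sym iso; apply: nex; exists i.
  - by move=> iso; apply: nex; exists j.
  - by case: nij; apply/eqP; rewrite eqn_leq (leq_trans i_n nj) (leq_trans j_n ni).
left; split; first by exists M0.
move=> M N HM cM HN cN.
have [P [b pow]] := powerful_exists ctbL HU cU Hall.
have niso : ~ nonisolated b by move=> niso'; exact: (powerful_isolated cU lcU pow niso').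
have iso := isolated_all_isolated cU pow niso.
apply: (isolated_types_isomorphic completeT) => //; exact: (isolated_types_model completeT HU cU).
Qed.
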